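(* Consider the distributed problem with $L$-Lipschitz gradients, the stochastic oracle with variance bound $\sigma^2$, and the LocalSGD algorithm with communication interval $\tau\ge 2$, $R$ communication rounds and $T=\tau R$ iterations, all as described in the context. Let $\Delta=f(\bar{\mathbf x}_0)-f^*$. Assume: (i) (standard gradient similarity) for some $\zeta\ge 0$, $\sup_{\mathbf x\in\mathbb R^d}\frac1n\sum_{i=1}^n\|\nabla f_i(\mathbf x)-\nabla f(\mathbf x)\|_2^2\le\zeta^2$; (ii) (uniform Hessian similarity) for some $\bar\delta\in[0,2L]$, $\|\nabla f_i(\mathbf x)-\nabla f(\mathbf x)-\nabla f_i(\mathbf y)+\nabla f(\mathbf y)\|_2\le\bar\delta\|\mathbf x-\mathbf y\|_2$ for all $\mathbf x,\mathbf y\in\mathbb R^d$ and all $i\in\{1,\dots,n\}$; (iii) (Lipschitz continuous Hessian) for some $\mathcal M\ge0$, there exists at least one function $\hat f$ in the convex hull $\{\sum_{i=1}^n a_if_i:\ a_i\ge0 \text{ for all } i,\ \sum_{i=1}^n a_i=1\}$ such that $\|\nabla^2\hat f(\mathbf x)-\nabla^2\hat f(\mathbf y)\|_2\le\mathcal M\|\mathbf x-\mathbf y\|_2$ for all $\mathbf x,\mathbf y\in\mathbb R^d$. Then there exists $\eta>0$ such that LocalSGD with stepsize $\eta$ ensures the following upper bound: $$\frac1T\sum_{t=0}^{T-1}\mathbb E\|\nabla f(\bar{\mathbf x}_t)\|_2^2\le \mathcal O\left(\frac{L\Delta}{R}+\sqrt{\frac{L\Delta\sigma^2}{n\tau R}}+\Big(\frac{\bar\delta\Delta\zeta}{R}\Big)^{2/3}+\frac{(L\Delta\sigma)^{2/3}}{\tau^{1/3}R^{2/3}}+\Big(\frac{\mathcal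 M^2\Delta^4\zeta^4}{R^4}\Big)^{1/5}\right),$$ where $\mathcal O(\cdot)$ hides an absolute numerical constant.
   Context: Setting. There are $n$ workers and local functions $f_1,\dots,f_n:\mathbb R^d\to\mathbb R$ (possibly non-convex), each with $L$-Lipschitz continuous gradient, $L>0$. Put $f=\frac1n\sum_{i=1}^n f_i$, assumed bounded below, and $f^*=\inf_{\mathbf x\in\mathbb R^d}f(\mathbf x)$. $\|\cdot\|_2$ is the Euclidean norm for vectors and the spectral norm for matrices. Stochastic oracle. At iteration $t\in\{0,\dots,T-1\}$, worker $i$ at point $\mathbf x_t^i$ receives $\mathbf g_t^i=G_i(\mathbf x_t^i,\xi_t^i)$, where $G_i$ is a Borel function, $\{\xi_t^i: 0\le t\le T-1\}$ are i.i.d. random variables for each $i\in\{1,\dots,n\}$, and $\mathbb E_{\xi_t^i}[G_i(\mathbf x,\xi_t^i)]=\nabla f_i(\mathbf x)$ and $\mathbb E_{\xi_t^i}\|G_i(\mathbf x,\xi_t^i)-\nabla f_i(\mathbf x)\|_2^2\le\sigma^2$. LocalSGD. Let $\tau\ge2$ be an integer (communication interval), $T$ the total number of iterations, assumed to be a multiple of $\tau$, $R=T/\tau$ the number of communication rounds, and $\eta>0$ the stepsize. The workers start from a common point $\mathbf x_0^1=\dots=\mathbf x_0^n$, and $\bar{\mathbf x}_t=\frac1n\sum_{i=1}^n\mathbf x_t^i$. For each $i\in\{1,\dots,n\}$ and $t\in\{0,\dots,T-1\}$: if $t+1$ is a multiple of $\tau$, then $\mathbf x_{t+1}^i=\bar{\mathbf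 x}_{t-\tau+1}-\frac{\eta}{n}\sum_{j=1}^n\sum_{k=0}^{\tau-1}\mathbf g_{t-k}^j$; otherwise $\mathbf x_{t+1}^i=\mathbf x_t^i-\eta\,\mathbf g_t^i$.
   Formalization: The formal statement assumes Δ > 0 (for Δ = 0 and σ > 0 the bound is 0, yet noise moves the iterates off the minimizer) and takes the samples independent across workers as well as across iterations (with common noise the 1/n in the variance term fails). *)

(* Defs.v *)
From HB Require Import structures.
From mathcomp Require Import all_boot all_order all_algebra.
From mathcomp Require Import all_classical all_reals all_analysis.
Import Order.TTheory GRing.Theory Num.Theory.
Import numFieldNormedType.Exports.

Set Implicit Arguments.
Unset Strict Implicit.
Unset Printing Implicit Defensive.

Local Open Scope classical_set_scope.
Local Open Scope ring_scope.

(* The canonical norm on 'rV[R]_d is the sup norm; all quantitative statements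
   use the Euclidean norm below. *)
Definition norm2 (R : realType) (d : nat) (x : 'rV[R]_d) : R :=
  Num.sqrt (\sum_(j < d) x 0 j ^+ 2).

(* Row vectors act on the left, the convention of the library's Jacobian. *)
Definition spectral_norm (R : realType) (m d : nat) (A : 'M[R]_(m, d)) : R :=
  sup [set norm2 (v *m A) | v in [set v : 'rV[R]_m | norm2 v <= 1]].

Definition grad (R : realType) (d : nat) (f : 'rV[R]_d -> R) (x : 'rV[R]_d)
  : 'rV[R]_d := \row_j 'D_(delta_mx 0 j) (f : 'rV[R]_d -> R^o) x.

Definition hessian (R : realType) (d : nat) (f : 'rV[R]_d -> R) (x : 'rV[R]_d)
  : 'M[R]_d := 'J (grad f) x.

Definition mean (R : realType) (n d : nat) (x : 'I_n -> 'rV[R]_d) : 'rV[R]_d :=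
  n%:R^-1 *: \sum_(i < n) x i.

Definition favg (R : realType) (n d : nat) (f : 'I_n -> 'rV[R]_d -> R)
  : 'rV[R]_d -> R := fun x => n%:R^-1 * \sum_(i < n) f i x.

Definition lipschitz_gradient (R : realType) (d : nat) (L : R)
    (f : 'rV[R]_d -> R) : Prop :=
  (forall x, differentiable (f : 'rV[R]_d -> R^o) x) /\
  (forall x y, norm2 (grad f x - grad f y) <= L * norm2 (x - y)).

Definition gradient_similarity (R : realType) (n d : nat) (zeta : R)
    (f : 'I_n -> 'rV[R]_d -> R) : Prop :=
  (ereal_sup (range (fun x : 'rV[R]_d =>
     (n%:R^-1 * \sum_(i < n) norm2 (grad (f i) x - grad (favg f) x) ^+ 2)%:E))
   <= (zeta ^+ 2)%:E)%E.

Definition hessian_similarity (R : realType) (n d : nat) (delta : R)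
    (f : 'I_n -> 'rV[R]_d -> R) : Prop :=
  forall (x y : 'rV[R]_d) (i : 'I_n),
    norm2 (grad (f i) x - grad (favg f) x - grad (f i) y + grad (favg f) y)
      <= delta * norm2 (x - y).

Definition conv_hull (R : realType) (n d : nat) (f : 'I_n -> 'rV[R]_d -> R)
  : set ('rV[R]_d -> R) :=
  [set h | exists a : 'I_n -> R,
     [/\ forall i, 0 <= a i, \sum_(i < n) a i = 1
       & h = (fun x => \sum_(i < n) a i * f i x)]].

Definition lipschitz_hessian (R : realType) (d : nat) (M : R)
    (h : 'rV[R]_d -> R) : Prop :=
  [/\ forall x, differentiable (h : 'rV[R]_d -> R^o) x,
      forall x, differentiable (grad h) x
    & forall x y, spectral_norm (hessian h x - hessian h y) <= M * norm2 (x - y)].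

(* R^d with its Borel sigma-algebra, generated by the open sets. *)
Definition borel_rV (R : realType) (d : nat) :=
  g_sigma_algebraType (@open 'rV[R]_d).

Definition mutually_independent (R : realType) (dO : measure_display)
    (Omega : measurableType dO) (P : probability Omega R) (I : finType)
    (dX : I -> measure_display) (X : forall i, measurableType (dX i))
    (Y : forall i, {RV P >-> X i}) : Prop :=
  forall (J : {set I}) (A : forall i, set (X i)),
    (forall i, measurable (A i)) ->
    P (\bigcap_(i in [set` J]) (Y i @^-1` A i)) =
    (\prod_(i in J) P (Y i @^-1` A i))%E.

Definition stochastic_samples (R : realType) (dO : measure_display)
    (Omega : measurableType dO) (P : probability Omega R) (n T : nat)
    (dX : 'I_n -> measure_display) (X : forall i, measurableType (dX i))
    (xi : forall i, nat -> {RV P >-> X i}) : Prop :=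
  (* The samples are independent across workers as well as across iterations,
     while the common law of a worker's samples may depend on the worker. *)
  @mutually_independent R dO Omega P ('I_n * 'I_T)%type
    (fun it => dX it.1) (fun it => X it.1) (fun it => xi it.1 it.2) /\
  (forall (i : 'I_n) (s t : nat), (s < T)%N -> (t < T)%N ->
    forall A, measurable A ->
      distribution P (xi i s) A = distribution P (xi i t) A).

Definition stochastic_oracle (R : realType) (dO : measure_display)
    (Omega : measurableType dO) (P : probability Omega R) (n d T : nat)
    (f : 'I_n -> 'rV[R]_d -> R) (sigma : R)
    (dX : 'I_n -> measure_display) (X : forall i, measurableType (dX i))
    (xi : forall i, nat -> {RV P >-> X i})
    (G : forall i, 'rV[R]_d -> X i -> 'rV[R]_d) : Prop :=
  (forall i, measurable_fun [set: (borel_rV R d * X i)%type]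
     (fun p => G i p.1 p.2 : borel_rV R d)) /\
  (forall i t, (t < T)%N -> forall x : 'rV[R]_d,
    (forall j, P.-integrable setT (fun w => (G i x (xi i t w) 0 j)%:E) /\
       'E_P[(fun w => G i x (xi i t w) 0 j)%R]%E = (grad (f i) x 0 j)%:E) /\
    ('E_P[(fun w => norm2 (G i x (xi i t w) - grad (f i) x) ^+ 2)%R]
       <= (sigma ^+ 2)%:E)%E).

(* x t i w is the iterate of worker i at time t on the outcome w. The equations
   determine x t for all t <= T, so such an x exists and is unique up to T. *)
Definition local_sgd (R : realType) (Omega : Type) (n d T tau : nat)
    (X : 'I_n -> Type) (xi : forall i, nat -> Omega -> X i)
    (G : forall i, 'rV[R]_d -> X i -> 'rV[R]_d)
    (x0 : 'rV[R]_d) (eta : R) (x : nat -> 'I_n -> Omega -> 'rV[R]_d) : Prop :=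
  let g t i w := G i (x t i w) (xi i t w) in
  (forall i w, x 0%N i w = x0) /\
  (forall t i w, (t < T)%N ->
    x t.+1 i w =
      if (tau %| t.+1)%N then
        mean (fun j => x (t.+1 - tau)%N j w)
        - (eta / n%:R) *: \sum_(j < n) \sum_(k < tau) g (t - k)%N j w
      else x t i w - eta *: g t i w).

(* Main.v *)
From HB Require Import structures.
Require Import Defs.
From mathcomp Require Import all_boot all_order all_algebra.
From mathcomp Require Import all_classical all_reals all_analysis.
From mathcomp Require Import measurable_realfun.
From mathcomp Require Import ring lra zify.
Import Order.TTheory GRing.Theory Num.Theory.
Import numFieldNormedType.Exports.

Set Implicit Arguments.
Unset Strict Implicit.
Unset Printing Implicit Defensive.

Local Open Scope classical_set_scope.
Local Open Scope ring_scope.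

(** The mean iterate performs inexact gradient descent on the average function
    [F = favg f]: at every step, synchronised or not,
    [xbar_(t+1) = xbar_t - eta * mean_i g_t^i], where [g_t^i] is the gradient of
    [f i] at the local point plus a noise of mean zero.  Put
    [a = grad F (xbar_t)], [b = mean_i (grad (f i) (x_t^i))] and let [m] be the
    mean of the noises.  The first-order upper bound for [F] gives, on every
    sample path ([step_descent]),
    [F (xbar_(t+1)) <= F (xbar_t) - eta/2 |a|^2 + eta/2 |b - a|^2
       + L eta^2 |m|^2 + <Q, m>],
    where [Q] is a combination of [a] and [b].  In expectation the last term
    vanishes, and [E |m|^2 <= sigma^2 / n] because the noises of different
    workers are orthogonal.  It remains to bound the bias [b - a].

    Let [y^i] be the noiseless gradient descent on [f i], restarted at the common
    point at the beginning of each round.  Second moments of the noise only give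
    second moments of [x^i - y^i], of order [tau eta^2 sigma^2]
    ([noise_drift]), so this part of the bias is paid for with the constant [L].
    The spread of the [y^i] is, on the contrary, bounded surely: comparison with
    gradient descent on [F] yields an average square of at most
    [W = 10 (eta tau)^2 zeta^2] ([gd_drift]).  For the points [y^i] write
    [grad (f i) = (grad (f i) - grad h) + grad h], where [h] has a Lipschitz
    Hessian.  The first summand is Lipschitz with a constant of order [delta]; in
    the second the linear term of the Taylor expansion at the mean of the [y^i]
    cancels on averaging, which leaves an error of order [M W] ([bias_le]).
    Altogether, with [gamma = eta tau],
    [(1/T) sum_t E |grad F (xbar_t)|^2 <= 2 Delta / (gamma K)
       + 2 L gamma sigma^2 / (n tau) + 12 L^2 gamma^2 sigma^2 / tau
       + 240 delta^2 gamma^2 zeta^2 + 600 M^2 gamma^4 zeta^4],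
    and [stepsize_exists] chooses [gamma].

    The conditional expectations are replaced by orthogonality relations.  The
    samples other than the one of worker [i] at time [t] generate a
    sigma-algebra that is independent of that sample ([others_indep], by the
    pi-lambda theorem), so a joint law is a product and Fubini's theorem shows
    that the noise of worker [i] at time [t] is orthogonal to every
    square-integrable vector determined by the other samples
    ([noise_orthogonal]). *)

(** * Euclidean geometry of row vectors *)

Section Euclid.
Variables (R : realType) (d : nat).
Implicit Types (x y z : 'rV[R]_d) (a c : R).

(** The Euclidean inner product, whose associated norm is [norm2]. *)
Definition dotp x y : R := \sum_(j < d) x 0 j * y 0 j.

(** The squared Euclidean norm. *)
Definition sqn x : R := dotp x x.

Lemma norm2_sqr x : norm2 x ^+ 2 = sqn x.
Proof.
rewrite /norm2 sqr_sqrtr; last by apply: sumr_ge0 => j _; exact: sqr_ge0.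
by apply: eq_bigr => j _; rewrite expr2.
Qed.

Lemma dotpC x y : dotp x y = dotp y x.
Proof. by apply: eq_bigr => j _; rewrite mulrC. Qed.

Lemma dotpDl x y z : dotp (x + y) z = dotp x z + dotp y z.
Proof. by rewrite -big_split; apply: eq_bigr => j _; rewrite !mxE mulrDl. Qed.

Lemma dotpZl a x y : dotp (a *: x) y = a * dotp x y.
Proof. by rewrite mulr_sumr; apply: eq_bigr => j _; rewrite !mxE mulrA. Qed.

Lemma dotpDr x y z : dotp x (y + z) = dotp x y + dotp x z.
Proof. by rewrite dotpC dotpDl !(dotpC x). Qed.

Lemma dotpZr a x y : dotp x (a *: y) = a * dotp x y.
Proof. by rewrite dotpC dotpZl dotpC. Qed.

Lemma dotpNl x y : dotp (- x) y = - dotp x y.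
Proof. by rewrite -scaleN1r dotpZl mulN1r. Qed.

Lemma dotpNr x y : dotp x (- y) = - dotp x y.
Proof. by rewrite dotpC dotpNl dotpC. Qed.

Lemma dotp0l x : dotp 0 x = 0.
Proof. by rewrite -(scale0r 0) dotpZl mul0r. Qed.

Lemma dotp_suml (I : Type) (r : seq I) (F : I -> 'rV[R]_d) y :
  dotp (\sum_(i <- r) F i) y = \sum_(i <- r) dotp (F i) y.
Proof.
elim: r => [|i r IH]; first by rewrite !big_nil dotp0l.
by rewrite !big_cons dotpDl IH.
Qed.

Lemma dotp_sumr (I : Type) (r : seq I) (F : I -> 'rV[R]_d) y :
  dotp y (\sum_(i <- r) F i) = \sum_(i <- r) dotp y (F i).
Proof. by rewrite dotpC dotp_suml; apply: eq_bigr => i _; rewrite dotpC. Qed.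

Definition dotpE := (dotpDl, dotpDr, dotpZl, dotpZr, dotpNl, dotpNr).

Lemma sqn_ge0 x : 0 <= sqn x.
Proof. by apply: sumr_ge0 => j _; rewrite -expr2 sqr_ge0. Qed.

Lemma norm2_ge0 x : 0 <= norm2 x.
Proof. exact: sqrtr_ge0. Qed.

Lemma sqn0 : sqn 0 = 0.
Proof. exact: dotp0l. Qed.

Lemma sqnZ a x : sqn (a *: x) = a ^+ 2 * sqn x.
Proof. by rewrite /sqn !dotpE mulrA expr2. Qed.

Lemma sqnN x : sqn (- x) = sqn x.
Proof. by rewrite /sqn !dotpE opprK. Qed.

Lemma sqnD x y : sqn (x + y) = sqn x + 2 * dotp x y + sqn y.
Proof. by rewrite /sqn !dotpE (dotpC y x); ring. Qed.

Lemma sqnB x y : sqn (x - y) = sqn x - 2 * dotp x y + sqn y.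
Proof. by rewrite sqnD sqnN dotpNr mulrN. Qed.

Lemma sqnD_young c x y : 0 < c ->
  sqn (x + y) <= (1 + c) * sqn x + (1 + c^-1) * sqn y.
Proof.
move=> c0; have /= := sqn_ge0 (c *: x - y).
rewrite sqnB sqnZ dotpZl => h.
have -> : sqn (x + y) = (1 + c) * sqn x + (1 + c^-1) * sqn y
    - c^-1 * (c ^+ 2 * sqn x - 2 * (c * dotp x y) + sqn y).
  rewrite sqnD; field; exact: lt0r_neq0.
by rewrite gerBl; apply: mulr_ge0 => //; rewrite invr_ge0 ltW.
Qed.

Lemma sqnD_le2 x y : sqn (x + y) <= 2 * sqn x + 2 * sqn y.
Proof.
have := sqn_ge0 (x - y).
rewrite sqnB sqnD; lra.
Qed.

Lemma sqnD3_le3 x y z : sqn (x + y + z) <= 3 * (sqn x + sqn y + sqn z).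
Proof.
have := sqn_ge0 (x - y); have := sqn_ge0 (x - z); have := sqn_ge0 (y - z).
rewrite !sqnB (sqnD (x + y)) sqnD dotpDl; lra.
Qed.

(** The Cauchy-Schwarz inequality. *)
Lemma normr_dotp_le x y : `|dotp x y| <= norm2 x * norm2 y.
Proof.
rewrite -(@ler_pXn2r _ 2) ?nnegrE ?mulr_ge0 ?norm2_ge0//.
rewrite real_normK ?num_real// exprMn !norm2_sqr.
have [y0|y0] := eqVneq (sqn y) 0.
  have y_eq0 : y = 0.
    apply/rowP => j; rewrite mxE; apply/eqP; rewrite -(sqrf_eq0 (y 0 j)).
    move/eqP: y0; rewrite psumr_eq0; last by move=> i _; rewrite -expr2 sqr_ge0.
    by move=> /allP/(_ j); rewrite mem_index_enum expr2; exact.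
  by rewrite y_eq0 dotpC dotp0l sqn0 mulr0 expr0n.
have yp : 0 < sqn y by rewrite lt_def y0 sqn_ge0.
have := sqn_ge0 (sqn y *: x - dotp x y *: y).
rewrite sqnB !sqnZ !dotpE => h.
have {}h : 0 <= sqn y * (sqn x * sqn y - dotp x y ^+ 2) by move: h; lra.
by move: h; rewrite pmulr_rge0// subr_ge0.
Qed.

Lemma norm2_le_sqn c x : norm2 x <= c -> sqn x <= c ^+ 2.
Proof. by move=> h; rewrite -norm2_sqr lerXn2r// nnegrE ?norm2_ge0// (le_trans _ h)// norm2_ge0. Qed.

Lemma norm2Z a x : norm2 (a *: x) = `|a| * norm2 x.
Proof.
apply/eqP; rewrite -(@eqrXn2 _ 2)// ?mulr_ge0 ?norm2_ge0//.
by rewrite exprMn !norm2_sqr sqnZ real_normK ?num_real.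
Qed.

(** Jensen's inequality for the squared norm. *)
Lemma sqn_convex (I : finType) (a : I -> R) (p : I -> 'rV[R]_d) :
  (forall i, 0 <= a i) -> \sum_i a i = 1 ->
  sqn (\sum_i a i *: p i) <= \sum_i a i * sqn (p i).
Proof.
move=> a0 a1; set q := \sum_i _.
have : 0 <= \sum_i a i * sqn (p i - q).
  by apply: sumr_ge0 => i _; rewrite mulr_ge0 ?sqn_ge0.
under eq_bigr do rewrite sqnB mulrDr mulrBr.
rewrite big_split/= sumrB -[X in _ + X]mulr_suml a1 mul1r.
have -> : \sum_i a i * (2 * dotp (p i) q) = 2 * sqn q.
  rewrite {2}/q /sqn dotp_suml mulr_sumr; apply: eq_bigr => i _.
  by rewrite dotpZl mulrCA.
lra.
Qed.

End Euclid.

(** The average of [n] real numbers, the scalar counterpart of [mean]. *)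
Definition avg (R : realType) (n : nat) (u : 'I_n -> R) : R :=
  n%:R^-1 * \sum_(i < n) u i.

Section Average.
Variables (R : realType) (n d : nat).
Hypothesis n0 : (0 < n)%N.
Implicit Types (u v : 'I_n -> R) (p q : 'I_n -> 'rV[R]_d).

Let nR0 : n%:R != 0 :> R. Proof. by rewrite pnatr_eq0 -lt0n. Qed.

Lemma avg_weights : \sum_(i < n) (n%:R^-1 : R) = 1.
Proof. by rewrite sumr_const card_ord -[LHS]mulr_natr mulVf. Qed.

Lemma avg_le u v : (forall i, u i <= v i) -> avg u <= avg v.
Proof. by move=> h; rewrite ler_wpM2l ?invr_ge0// ler_sum. Qed.

Lemma avg_ge0 u : (forall i, 0 <= u i) -> 0 <= avg u.
Proof. by move=> h; rewrite mulr_ge0 ?invr_ge0// sumr_ge0. Qed.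

Lemma avg_cst (c : R) : avg (fun _ : 'I_n => c) = c.
Proof. by rewrite /avg mulr_sumr -mulr_suml avg_weights mul1r. Qed.

Lemma avgZ (c : R) u : avg (fun i => c * u i) = c * avg u.
Proof. by rewrite /avg -mulr_sumr mulrCA. Qed.

Lemma avgD u v : avg (fun i => u i + v i) = avg u + avg v.
Proof. by rewrite /avg big_split mulrDr. Qed.

Lemma meanD p q : mean (fun i => p i + q i) = mean p + mean q.
Proof. by rewrite /mean big_split scalerDr. Qed.

Lemma meanN p : mean (fun i => - p i) = - mean p.
Proof. by rewrite /mean sumrN scalerN. Qed.

Lemma meanZ (c : R) p : mean (fun i => c *: p i) = c *: mean p.
Proof. by rewrite /mean -scaler_sumr !scalerA mulrC. Qed.

Lemma mean_cst (x : 'rV[R]_d) : mean (fun _ : 'I_n => x) = x.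
Proof. by rewrite /mean scaler_sumr -scaler_suml avg_weights scale1r. Qed.

Lemma sqn_mean_le p : sqn (mean p) <= avg (fun i => sqn (p i)).
Proof.
rewrite /mean scaler_sumr /avg mulr_sumr.
by apply: sqn_convex => [i|]; rewrite ?invr_ge0// avg_weights.
Qed.

Lemma dotp_meanl p y : dotp (mean p) y = avg (fun i => dotp (p i) y).
Proof. by rewrite /mean dotpZl dotp_suml. Qed.

(** The mean minimises the average squared distance. *)
Lemma avg_sqn_mean p (z : 'rV[R]_d) :
  avg (fun i => sqn (p i - mean p)) <= avg (fun i => sqn (p i - z)).
Proof.
have -> : avg (fun i => sqn (p i - z)) =
    avg (fun i => sqn (p i - mean p)) + sqn (mean p - z).
  rewrite -[sqn (mean p - z)]addr0 -(avg_cst (sqn _)).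
  have -> : 0 = avg (fun i => 2 * dotp (p i - mean p) (mean p - z)) :> R.
    by rewrite avgZ -dotp_meanl meanD mean_cst subrr dotp0l mulr0.
  rewrite -!avgD; congr avg; apply/funext => i.
  have -> : p i - z = (p i - mean p) + (mean p - z).
    by rewrite addrA subrK.
  by rewrite [in LHS]sqnD; ring.
by rewrite lerDl sqn_ge0.
Qed.

End Average.

(** * Gradients and second-order estimates *)

Section Calculus.
Variables (R : realType) (d : nat).
Implicit Types (f g h : 'rV[R]_d -> R) (x y v u : 'rV[R]_d).

(** The derivative of [f] along the line [x + r *: v] is its directional
    derivative. *)
Lemma is_derive_line f x v (s : R) :
  derivable (f : 'rV[R]_d -> R^o) (x + s *: v) v ->
  is_derive s (1 : R) ((fun r : R => f (x + r *: v)) : R -> R^o) ('D_v (f : _ -> R^o) (x + s *: v)).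
Proof.
have E : (fun h : R => h^-1 *: ((f (x + (h *: (1 : R) + s) *: v) : R^o) - f (x + s *: v)))
  = (fun h : R => h^-1 *: ((f (h *: v + (x + s *: v)) : R^o) - f (x + s *: v))).
  apply/funext => h; congr (_ *: (f _ - _)).
  by rewrite scalerDl -scalerA scale1r addrCA.
move=> df; apply: DeriveDef; first by rewrite /derivable /= E.
by rewrite /derive /= E.
Qed.

Lemma mvt_line f x v :
  (forall y, derivable (f : 'rV[R]_d -> R^o) y v) ->
  exists2 s : R, 0 <= s <= 1 & f (x + v) - f x = 'D_v (f : _ -> R^o) (x + s *: v).
Proof.
move=> df.
have [] := @MVT R (fun r => f (x + r *: v)) (fun s => 'D_v (f : _ -> R^o) (x + s *: v)) 0 1 ltr01.
- by move=> s _; exact: is_derive_line.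
- apply: continuous_subspaceT => s; apply: differentiable_continuous.
  by apply/derivable1_diffP; have [] := is_derive_line (df (x + s *: v)).
move=> s; rewrite in_itv/= => /andP[s0 s1]; rewrite scale1r scale0r addr0 subr0 mulr1.
by exists s => //; rewrite !ltW.
Qed.

Lemma derive_dotp_grad f x v : differentiable (f : 'rV[R]_d -> R^o) x ->
  'D_v (f : _ -> R^o) x = dotp (grad f x) v.
Proof.
move=> df; rewrite deriveE// {1}[v]row_sum_delta linear_sum/=.
rewrite dotpC; apply: eq_bigr => j _; rewrite linearZ/= mxE.
by rewrite deriveE.
Qed.

Lemma grad_comb (n : nat) (a : 'I_n -> R) (f : 'I_n -> 'rV[R]_d -> R) x :
  (forall i, differentiable (f i : 'rV[R]_d -> R^o) x) ->
  grad (fun y => \sum_(i < n) a i * f i y) x = \sum_(i < n) a i *: grad (f i) x.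
Proof.
move=> df; apply/rowP => j; rewrite mxE summxE.
have -> : (fun y => \sum_(i < n) a i * f i y) =
    (\sum_(i < n) (a i *: (f i : 'rV[R]_d -> R^o))) :> ('rV[R]_d -> R^o).
  by apply/funext => y; rewrite fct_sumE.
rewrite derive_sum; last by move=> i; apply: derivableZ; exact: diff_derivable.
by apply: eq_bigr => i _; rewrite deriveZ/= ?mxE//; exact: diff_derivable.
Qed.

Lemma favgE (n : nat) (f : 'I_n -> 'rV[R]_d -> R) :
  favg f = (fun y => \sum_(i < n) n%:R^-1 * f i y).
Proof. by apply/funext => y; rewrite /favg mulr_sumr. Qed.

Lemma grad_favg (n : nat) (f : 'I_n -> 'rV[R]_d -> R) x :
  (forall i, differentiable (f i : 'rV[R]_d -> R^o) x) ->
  grad (favg f) x = mean (fun i => grad (f i) x).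
Proof. by move=> df; rewrite favgE grad_comb// -scaler_sumr. Qed.

Lemma differentiable_favg (n : nat) (f : 'I_n -> 'rV[R]_d -> R) x :
  (forall i, differentiable (f i : 'rV[R]_d -> R^o) x) ->
  differentiable (favg f : 'rV[R]_d -> R^o) x.
Proof.
move=> df; have -> : favg f =
    (\sum_(i < n) (n%:R^-1 *: (f i : 'rV[R]_d -> R^o))) :> ('rV[R]_d -> R^o).
  by apply/funext => y; rewrite favgE fct_sumE.
by apply: differentiable_sum => i; exact: differentiableZ.
Qed.

(** First-order upper bound; the constant is not the sharp [L / 2]. *)
Lemma descent (L : R) f x v : 0 < L -> lipschitz_gradient L f ->
  f (x + v) <= f x + dotp (grad f x) v + L * sqn v.
Proof.
move=> L0 [df lf]; rewrite -lerBlDl opprD addrA.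
have [|s /andP[s0 s1] ->] := @mvt_line f x v; first by move=> y; exact: diff_derivable.
rewrite derive_dotp_grad// -dotpNl -dotpDl.
apply: le_trans (ler_norm _) _; apply: le_trans (normr_dotp_le _ _) _.
rewrite -norm2_sqr expr2 mulrA ler_wpM2r ?norm2_ge0//.
apply: le_trans (lf _ _) _.
have -> : x + s *: v - x = s *: v by rewrite addrC addKr.
rewrite norm2Z ger0_norm// ler_wpM2l ?(ltW L0)//.
by rewrite ler_piMl ?norm2_ge0.
Qed.

Lemma lipschitz_sqn (L : R) f x y : lipschitz_gradient L f ->
  sqn (grad f x - grad f y) <= L ^+ 2 * sqn (x - y).
Proof. by move=> [_ lf]; rewrite -(norm2_sqr (x - y)) -exprMn norm2_le_sqn. Qed.

Lemma norm2_0 : norm2 (0 : 'rV[R]_d) = 0.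
Proof. by rewrite /norm2 big1 ?sqrtr0// => j _; rewrite mxE expr0n. Qed.

Lemma normr_coord_le v j : `|v 0 j| <= norm2 v.
Proof.
rewrite -(@ler_pXn2r _ 2) ?nnegrE ?norm2_ge0// norm2_sqr real_normK ?num_real//.
rewrite /sqn /dotp (bigD1 j)//= -expr2 lerDl.
by apply: sumr_ge0 => i _; rewrite -expr2 sqr_ge0.
Qed.

Lemma norm2_sum_le (I : Type) (r : seq I) (F : I -> 'rV[R]_d) :
  norm2 (\sum_(i <- r) F i) <= \sum_(i <- r) norm2 (F i).
Proof.
elim: r => [|i r IH].
  by rewrite !big_nil norm2_0.
rewrite !big_cons; apply: le_trans (lerD (lexx _) IH).
set s := \sum_(j <- r) F j.
rewrite -(@ler_pXn2r _ 2) ?nnegrE ?addr_ge0 ?norm2_ge0//.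
have := normr_dotp_le (F i) s; have := ler_norm (dotp (F i) s).
rewrite sqrrD !norm2_sqr sqnD; lra.
Qed.

(** The set defining the spectral norm is bounded, so that [v *m A] is bounded
    by the spectral norm of [A] times the length of [v]. *)
Lemma norm2_mulmx_le (A : 'M[R]_d) v :
  norm2 (v *m A) <= spectral_norm A * norm2 v.
Proof.
set S := [set norm2 (u *m A) | u in [set u : 'rV[R]_d | norm2 u <= 1]].
have ubS : has_ubound S.
  exists (\sum_(i < d) norm2 (row i A)) => _ [u /= u1 <-].
  rewrite mulmx_sum_row; apply: le_trans (norm2_sum_le _ _) _.
  apply: ler_sum => i _; rewrite norm2Z ler_piMl ?norm2_ge0//.
  exact: le_trans (normr_coord_le _ _) u1.
have [v0|v0] := eqVneq (norm2 v) 0.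
  have -> : v = 0.
    apply/rowP => j; rewrite mxE; apply/normr0_eq0/le_anti.
    by rewrite normr_ge0 -[X in _ <= X]v0 normr_coord_le.
  by rewrite mul0mx norm2_0 mulr0.
have vp : 0 < norm2 v by rewrite lt_def v0 norm2_ge0.
rewrite -ler_pdivrMr//; apply: (ub_le_sup ubS).
exists ((norm2 v)^-1 *: v); first by rewrite /= norm2Z gtr0_norm ?invr_gt0// mulVf.
by rewrite -scalemxAl norm2Z gtr0_norm ?invr_gt0// mulrC.
Qed.

(** Second-order estimate for a gradient, tested against a direction [u]; the
    constant is not the sharp [M / 2]. *)
Lemma hessian_taylor (M : R) h u x v : 0 <= M -> lipschitz_hessian M h ->
  dotp u (grad h (x + v) - grad h x - v *m hessian h x)
    <= norm2 u * (M * sqn v).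
Proof.
move=> M0 [_ dgh lh].
pose g y := dotp u (grad h y).
have gE : g = (\sum_(j < d) (u 0 j *: ((fun y => grad h y 0 j) : 'rV[R]_d -> R^o)))
    :> ('rV[R]_d -> R^o).
  by apply/funext => y; rewrite fct_sumE.
have dcoord y w j : derivable ((fun y => grad h y 0 j) : 'rV[R]_d -> R^o) y w.
  have /derivable_mxP : derivable (grad h) y w by exact: diff_derivable.
  exact.
have dg y w : derivable (g : 'rV[R]_d -> R^o) y w.
  by rewrite gE; apply: derivable_sum => j; apply: derivableZ.
have Dg y w : 'D_w (g : 'rV[R]_d -> R^o) y = dotp u (w *m hessian h y).
  rewrite gE derive_sum; last by move=> j; apply: derivableZ.
  rewrite -deriveEjacobian// derive_mx; last exact: diff_derivable.
  by apply: eq_bigr => j _; rewrite deriveZ//= mxE.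
rewrite !dotpE -/(g (x + v)) -/(g x).
have [|s /andP[s0 s1] ->] := @mvt_line g x v; first by move=> y.
rewrite Dg -dotpNr -dotpDr -mulmxBr.
apply: le_trans (ler_norm _) _; apply: le_trans (normr_dotp_le _ _) _.
rewrite ler_wpM2l ?norm2_ge0//.
apply: le_trans (norm2_mulmx_le _ _) _.
rewrite -norm2_sqr expr2 mulrA ler_wpM2r ?norm2_ge0//.
apply: le_trans (lh _ _) _.
have -> : x + s *: v - x = s *: v by rewrite addrC addKr.
by rewrite norm2Z ger0_norm// ler_wpM2l// ler_piMl ?norm2_ge0.
Qed.

End Calculus.

(** * Drift of the local trajectories *)

Section Drift.
Variables (R : realType) (d : nat).
Implicit Types (f g : 'rV[R]_d -> R) (x y z w : 'rV[R]_d).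

(** [gd eta f k w] is the [k]-th iterate of gradient descent on [f] from [w]. *)
Definition gd (eta : R) f (k : nat) w : 'rV[R]_d :=
  iter k (fun y => y - eta *: grad f y) w.

(** A gradient step expands distances by a factor of at most [1 + eta * L],
    hence squared distances by at most [1 + 3 * (eta * L)]. *)
Lemma gd_step_expand (L eta : R) f y z : 0 <= eta -> 0 < L -> eta * L <= 1 ->
  lipschitz_gradient L f ->
  sqn ((y - z) - eta *: (grad f y - grad f z)) <= (1 + 3 * (eta * L)) * sqn (y - z).
Proof.
move=> eta0 L0 etaL lf; set a := y - z; set b := grad f y - grad f z.
have sb : sqn b <= L ^+ 2 * sqn a by exact: lipschitz_sqn.
have dab : - dotp a b <= L * sqn a.
  apply: (@le_trans _ _ `|dotp a b|); first by rewrite -normrN ler_norm.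
  apply: le_trans (normr_dotp_le _ _) _; rewrite -norm2_sqr expr2 mulrA mulrC.
  by rewrite ler_wpM2r ?norm2_ge0//; case: lf => _; exact.
rewrite sqnB sqnZ dotpZr.
have a0 := sqn_ge0 a.
have h1 : eta * - dotp a b <= eta * (L * sqn a) by rewrite ler_wpM2l.
have h2 : eta ^+ 2 * sqn b <= eta ^+ 2 * (L ^+ 2 * sqn a).
  by rewrite ler_wpM2l// sqr_ge0.
have h3 : (eta * L) * (eta * L) * sqn a <= (eta * L) * sqn a.
  by rewrite ler_wpM2r// ler_piMr// mulr_ge0// ltW.
lra.
Qed.

(** A discrete Gronwall inequality: growth by a factor [1 + (2 * tau)^-1] during
    at most [tau] steps at most doubles the accumulated increments. *)
Lemma discrete_gronwall (tau m : nat) (u : nat -> R) (q : R) :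
  (0 < tau)%N -> (m <= tau)%N -> 0 <= q -> u 0%N <= 0 ->
  (forall k, (k < m)%N -> u k.+1 <= (1 + (2 * tau%:R)^-1) * u k + q) ->
  forall k, (k <= m)%N -> u k <= 2 * k%:R * q.
Proof.
move=> tau0 mtau q0 u0 hu; elim=> [_|k IH km]; first by rewrite mulr0 mul0r.
apply: le_trans (hu _ km) _.
have {}IH := IH (ltnW km); have ktau := leq_trans km mtau.
have t0 : 0 < tau%:R :> R by rewrite ltr0n.
have c0 : 0 <= 1 + (2 * tau%:R)^-1 :> R by rewrite addr_ge0// invr_ge0 mulr_ge0// ltW.
have h : (2 * tau%:R)^-1 * (2 * k%:R * q) <= q.
  rewrite mulrA ler_piMl// ler_pdivrMl ?mulr_gt0// mulr1.
  by rewrite ler_pM2l// ler_nat ltnW.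
have := ler_wpM2l c0 IH.
rewrite -natr1; move: h; set s := (_^-1); set K := k%:R; lra.
Qed.

Variables (n : nat) (f : 'I_n -> 'rV[R]_d -> R) (L : R).
Hypothesis n0 : (0 < n)%N.
Hypothesis L0 : 0 < L.
Hypothesis lf : forall i, lipschitz_gradient L (f i).

Let df i x : differentiable (f i : 'rV[R]_d -> R^o) x.
Proof. by case: (lf i) => h _; exact: h. Qed.

Lemma lipschitz_gradient_favg : lipschitz_gradient L (favg f).
Proof.
split=> [x|x y]; first exact: differentiable_favg.
rewrite !grad_favg// -meanN -meanD.
rewrite -(@ler_pXn2r _ 2) ?nnegrE ?mulr_ge0 ?norm2_ge0// ?(ltW L0)//.
rewrite exprMn !norm2_sqr; apply: le_trans (sqn_mean_le n0 _) _.
rewrite -[leRHS](avg_cst n0); apply: avg_le => i; exact: lipschitz_sqn.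
Qed.

Lemma avg_gradient_similarity (zeta : R) x : gradient_similarity zeta f ->
  avg (fun i => sqn (grad (f i) x - grad (favg f) x)) <= zeta ^+ 2.
Proof.
move=> h; rewrite -lee_fin; apply: le_trans h; apply: ereal_sup_ubound.
exists x => //; congr EFin; rewrite /avg; congr (_ * _).
by apply: eq_bigr => i _; rewrite norm2_sqr.
Qed.

(** Over at most [tau] noiseless local steps from a common point, the local
    trajectories stay close to the trajectory of gradient descent on the
    average function. *)
Lemma gd_drift (tau : nat) (eta zeta : R) w : (2 <= tau)%N ->
  0 <= eta -> 18 * (eta * tau%:R) * L <= 1 -> gradient_similarity zeta f ->
  forall k, (k <= tau)%N ->
  avg (fun i => sqn (gd eta (f i) k w - gd eta (favg f) k w))
    <= 10 * (eta * tau%:R) ^+ 2 * zeta ^+ 2.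
Proof.
move=> tau2 eta0 etaL simf k ktau.
have t2 : 2 <= tau%:R :> R by rewrite ler_nat.
have etaL1 : eta * L <= (18 * tau%:R)^-1.
  rewrite -[leRHS]mul1r ler_pdivlMr; last by lra.
  by apply: le_trans etaL; rewrite -subr_ge0 (_ : _ - _ = 0)//; ring.
have tI : (18 * tau%:R)^-1 <= 36^-1 :> R by rewrite lef_pV2 ?posrE; lra.
have q0 : 0 <= (1 + 4 * tau%:R) * (eta ^+ 2 * zeta ^+ 2).
  by apply: mulr_ge0; [lra|rewrite mulr_ge0 ?sqr_ge0].
have := @discrete_gronwall tau tau
  (fun k => avg (fun i => sqn (gd eta (f i) k w - gd eta (favg f) k w)))
  ((1 + 4 * tau%:R) * (eta ^+ 2 * zeta ^+ 2)) (ltnW tau2) (leqnn _) q0 _ _ k ktau.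
move=> H; apply: le_trans (H _ _) _.
- by rewrite /= -[X in _ <= X](avg_cst n0); apply: avg_le => i; rewrite subrr sqn0.
- move=> m _ /=.
  set y := fun i => gd eta (f i) m w; set z := gd eta (favg f) m w.
  have -> : (fun i => sqn (y i - eta *: grad (f i) (y i)
                - (z - eta *: grad (favg f) z))) =
     (fun i => sqn (((y i - z) - eta *: (grad (f i) (y i) - grad (f i) z))
              + (- eta) *: (grad (f i) z - grad (favg f) z))).
    apply/funext => i; congr sqn.
    move: (grad (f i) (y i)) (grad (f i) z) (grad (favg f) z) => g1 g2 g3.
    move: (y i) z => y' z'.
    by apply/rowP => j; rewrite !mxE; ring.
  (* Young's inequality with the weight [(4 * tau)^-1], small enough for the
     total growth factor to stay below [1 + (2 * tau)^-1]. *)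
  have c0 : 0 < (4 * tau%:R)^-1 :> R by rewrite invr_gt0; lra.
  apply: (@le_trans _ _ (avg (fun i => (1 + (2 * tau%:R)^-1) * sqn (y i - z)
      + (1 + 4 * tau%:R) * (eta ^+ 2 * sqn (grad (f i) z - grad (favg f) z))))).
    apply: avg_le => i; apply: le_trans (sqnD_young _ _ c0) _.
    rewrite invrK sqnZ sqrrN lerD2r.
    apply: (@le_trans _ _ ((1 + (4 * tau%:R)^-1) * ((1 + 3 * (eta * L)) * sqn (y i - z)))).
      apply: ler_wpM2l; first by lra.
      by apply: gd_step_expand => //; lra.
    rewrite [leLHS]mulrA; apply: ler_wpM2r; first exact: sqn_ge0.
    have -> : (2 * tau%:R)^-1 = 2 * (4 * tau%:R)^-1 :> R by field; lra.
    have E : (18 * tau%:R)^-1 = 4 / 18 * (4 * tau%:R)^-1 :> R by field; lra.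
    have : (4 * tau%:R)^-1 <= 8^-1 :> R by rewrite lef_pV2 ?posrE; lra.
    rewrite E in etaL1; set s := (4 * tau%:R)^-1 in c0 etaL1 *.
    move=> s8; have : s * (eta * L) <= s * 1 by rewrite ler_pM2l//; lra.
    have : s * (eta * L) <= s * (4 / 18 * s) by rewrite ler_pM2l.
    have : s * s <= s * 8^-1 by rewrite ler_pM2l.
    lra.
  rewrite avgD !avgZ lerD2l; apply: ler_wpM2l; first by lra.
  by rewrite ler_wpM2l ?sqr_ge0// avg_gradient_similarity.
have kt : k%:R <= tau%:R :> R by rewrite ler_nat.
have ez : 0 <= eta ^+ 2 * zeta ^+ 2 by rewrite mulr_ge0 ?sqr_ge0.
apply: (@le_trans _ _ (2 * tau%:R * ((5 * tau%:R) * (eta ^+ 2 * zeta ^+ 2)))).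
  apply: ler_pM.
  - exact: mulr_ge0.
  - by apply: mulr_ge0 => //; lra.
  - by rewrite ler_pM2l.
  - by apply: ler_wpM2r => //; lra.
rewrite -subr_ge0 (_ : _ - _ = 0)//; ring.
Qed.

Section Bias.
Variables (delta M : R) (h : 'rV[R]_d -> R).
Hypothesis sim : hessian_similarity delta f.
Hypothesis hh : conv_hull f h.
Hypothesis M0 : 0 <= M.
Hypothesis lh : lipschitz_hessian M h.

(** Hessian similarity with the average function passes to every function of
    the convex hull. *)
Lemma conv_hull_similarity i x y :
  sqn ((grad (f i) x - grad h x) - (grad (f i) y - grad h y))
    <= 4 * delta ^+ 2 * sqn (x - y).
Proof.
case: hh => a [a0 a1 hE].
pose q j := grad (f j) x - grad (favg f) x - grad (f j) y + grad (favg f) y.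
have sq j : sqn (q j) <= delta ^+ 2 * sqn (x - y).
  by rewrite -(norm2_sqr (x - y)) -exprMn; apply: norm2_le_sqn; exact: sim.
have -> : (grad (f i) x - grad h x) - (grad (f i) y - grad h y)
    = q i - \sum_j a j *: q j.
  have -> : \sum_j a j *: q j =
      (grad h x - grad h y) - (grad (favg f) x - grad (favg f) y).
    rewrite hE !grad_comb// -[X in _ = _ - X]scale1r -a1 scaler_suml -!sumrB.
    apply: eq_bigr => j _; rewrite -!scalerBr; congr (_ *: _).
    by rewrite /q; apply/rowP => k; rewrite !mxE; ring.
  by rewrite /q; apply/rowP => k; rewrite !mxE; ring.
rewrite -scaleN1r; apply: le_trans (sqnD_le2 _ _) _.
rewrite sqnZ sqrrN expr1n mul1r.
have : sqn (\sum_j a j *: q j) <= delta ^+ 2 * sqn (x - y).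
  apply: le_trans (sqn_convex _ a0 a1) _.
  rewrite -[leRHS]mul1r -[X in _ <= X * _]a1 mulr_suml.
  by apply: ler_sum => j _; rewrite ler_wpM2l.
have := sq i; lra.
Qed.

(** The difference between the averaged gradient at the points [x i] and the
    gradient of the average function at their mean. The squared spread [V] of the
    auxiliary points [y i] enters with the constants [delta] and [M]; the distance
    from [x i] to [y i] costs a factor [L]. *)
Lemma bias_le (x y : 'I_n -> 'rV[R]_d) (V : R) :
  avg (fun i => sqn (y i - mean y)) <= V ->
  sqn (mean (fun i => grad (f i) (x i)) - grad (favg f) (mean x))
  <= 6 * L ^+ 2 * avg (fun i => sqn (x i - y i))
     + 24 * delta ^+ 2 * V + 6 * M ^+ 2 * V ^+ 2.
Proof.
set V0 := avg _ => V0V.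
have V00 : 0 <= V0 by apply: avg_ge0 => i; exact: sqn_ge0.
set yb := mean y.
pose r i := grad h (yb + (y i - yb)) - grad h yb - (y i - yb) *m hessian h yb.
pose p i := (grad (f i) (y i) - grad h (y i)) - (grad (f i) yb - grad h yb).
have -> : mean (fun i => grad (f i) (x i)) - grad (favg f) (mean x) =
   mean (fun i => grad (f i) (x i) - grad (f i) (y i))
   + (grad (favg f) yb - grad (favg f) (mean x))
   + (mean p + mean r).
  have -> : mean r = mean (fun i => grad h (y i)) - grad h yb.
    rewrite /r 2!meanD meanN mean_cst// meanN.
    (* The deviations from the mean add up to zero, and so do the linear terms. *)
    have -> : mean (fun i => (y i - yb) *m hessian h yb) = 0.
      rewrite /mean -mulmx_suml scalemxAl -/(mean _).
      by rewrite meanD mean_cst// subrr mul0mx.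
    by rewrite subr0; under [in X in X - _]eq_fun do rewrite addrC subrK.
  rewrite /p !(meanD, meanN) mean_cst// (grad_favg (x := yb))//.
  by apply/rowP => k; rewrite !mxE; ring.
apply: le_trans (sqnD3_le3 _ _ _) _.
have h1 : sqn (mean (fun i => grad (f i) (x i) - grad (f i) (y i)))
    <= L ^+ 2 * avg (fun i => sqn (x i - y i)).
  apply: le_trans (sqn_mean_le n0 _) _; rewrite -avgZ; apply: avg_le => i.
  exact: lipschitz_sqn.
have h2 : sqn (grad (favg f) yb - grad (favg f) (mean x))
    <= L ^+ 2 * avg (fun i => sqn (x i - y i)).
  apply: le_trans (lipschitz_sqn _ _ lipschitz_gradient_favg) _.
  rewrite -sqnN opprB ler_wpM2l ?sqr_ge0// /yb -meanN -meanD.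
  exact: sqn_mean_le.
have h3 : sqn (mean p) <= 4 * delta ^+ 2 * V0.
  apply: le_trans (sqn_mean_le n0 _) _; rewrite -avgZ; apply: avg_le => i.
  exact: conv_hull_similarity.
have h4 : sqn (mean r) <= M ^+ 2 * V0 ^+ 2.
  have : sqn (mean r) <= norm2 (mean r) * (M * V0).
    rewrite {1}/sqn dotp_meanl /V0 -!avgZ; apply: avg_le => i.
    by rewrite dotpC; exact: hessian_taylor.
  rewrite -norm2_sqr expr2 -exprMn => {}h4.
  have [r0|r0] := eqVneq (norm2 (mean r)) 0; first by rewrite r0 mul0r sqr_ge0.
  have rp : 0 < norm2 (mean r) by rewrite lt_def r0 norm2_ge0.
  move: h4; rewrite ler_pM2l// => h4.
  rewrite -expr2; apply: lerXn2r => //; rewrite nnegrE; first exact: norm2_ge0.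
  exact: mulr_ge0.
have h5 := sqnD_le2 (mean p) (mean r).
have h6 : delta ^+ 2 * V0 <= delta ^+ 2 * V by rewrite ler_wpM2l ?sqr_ge0.
have h7 : M ^+ 2 * V0 ^+ 2 <= M ^+ 2 * V ^+ 2.
  rewrite ler_wpM2l ?sqr_ge0//; apply: lerXn2r => //.
  by rewrite nnegrE (le_trans V00).
lra.
Qed.

End Bias.
End Drift.

(** * Measurability of vector-valued maps *)

Section Borel.
Variables (R : realType) (d : nat).

Lemma measurable_open_rV (U : set 'rV[R]_d) :
  open U -> measurable (U : set (borel_rV R d)).
Proof. by move=> oU; exact: sub_sigma_algebra. Qed.

Lemma measurable_continuous_rV (g : 'rV[R]_d -> R) : continuous g ->
  measurable_fun setT (g : borel_rV R d -> R).
Proof.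
move=> cg; apply: (measurability _ (RGenInftyO.measurableE R)).
move=> _ [_ [a ->] <-]; rewrite setTI; apply: measurable_open_rV.
by apply: open_comp => [? _|]; [exact: cg|exact: lray_open].
Qed.

Lemma measurable_coord_rV j :
  measurable_fun setT ((fun v => v 0 j) : borel_rV R d -> R).
Proof. by apply: measurable_continuous_rV; exact: coord_continuous. Qed.

(** Every open set is a countable union of cubes with rational centres, so the
    Borel sets are generated by the coordinates. *)
Lemma measurable_fun_rVP (dS : measure_display) (S : measurableType dS)
    (g : S -> borel_rV R d) :
  (forall j, measurable_fun setT (fun s => g s 0 j)) -> measurable_fun setT g.
Proof.
move=> mg; apply: (@measurability _ _ _ _ setT g open) => //.
move=> _ [U oU <-]; rewrite setTI.
pose Box (p : 'rV[rat]_d * nat) : set 'rV[R]_d :=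
  [set y | forall j, `|ratr (p.1 0 j) - y 0 j| < p.2.+1%:R^-1].
have -> : g @^-1` U =
    \bigcup_p (if `[< Box p `<=` U >] then g @^-1` Box p else set0).
  apply/seteqP; split=> [s Os|s [p _]]; last first.
    by case: asboolP => // pU; apply: pU.
  have [e /= e0 eU] : nbhs_ball (g s) U by apply/nbhs_ballP; exact: open_nbhs_nbhs.
  have e2 : 0 < e / 2 by rewrite divr_gt0.
  have [m _ /(_ m (leqnn _)) /= hm] := near_infty_natSinv_lt (PosNum e2).
  have m0 : 0 < m.+1%:R^-1 :> R by rewrite invr_gt0.
  have hq j : exists q : rat, `|ratr q - g s 0 j| < m.+1%:R^-1.
    have /rat_in_itvoo[q] : g s 0 j - m.+1%:R^-1 < g s 0 j + m.+1%:R^-1.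
      by rewrite ltrBlDr -addrA ltrDl addr_gt0.
    rewrite in_itv/= => /andP[h1 h2]; exists q.
    by rewrite ltr_distl h1.
  pose q := \row_j xchoose (hq j).
  have sq : Box (q, m) (g s) by move=> j; rewrite mxE; exact: (xchooseP (hq j)).
  exists (q, m) => //; rewrite asboolT// => y qy; apply: eU; split=> //.
  move=> i j; rewrite (ord1 i) /ball/=.
  have := sq j; have := qy j; rewrite /= => h1 h2.
  rewrite (_ : g s 0 j - y 0 j = (ratr (q 0 j) - y 0 j) - (ratr (q 0 j) - g s 0 j)); last by ring.
  apply: le_lt_trans (ler_normB _ _) _.
  by rewrite [ltRHS]splitr ltrD// (lt_trans _ hm).
apply: countable_bigcupT_measurable => [|p]; first exact: countableP.
case: ifP => // _.
have -> : g @^-1` Box p =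
    \bigcap_(j in [set: 'I_d]) (fun s => g s 0 j) @^-1` (ball (ratr (p.1 0 j) : R) p.2.+1%:R^-1).
  by apply/seteqP; split=> [s h j _|s h j]; [exact: h|exact: h].
apply: fin_bigcap_measurable => [|j _]; first exact: finite_finset.
by rewrite -[X in measurable X]setTI; apply: mg => //; exact: measurable_ball.
Qed.

(** The Euclidean norm is dominated by the sum of the coordinates, which the
    topology of row vectors controls. *)
Lemma norm2_le_sum (x : 'rV[R]_d) : norm2 x <= \sum_j `|x 0 j|.
Proof.
rewrite {1}[x]row_sum_delta; apply: le_trans (norm2_sum_le _ _) _.
apply: ler_sum => j _; rewrite norm2Z ler_piMr//.
rewrite -(@ler_pXn2r _ 2) ?nnegrE ?norm2_ge0// norm2_sqr expr1n.
rewrite /sqn /dotp (bigD1 j)//= !mxE !eqxx mulr1 big1 ?addr0// => i ij.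
by rewrite !mxE (negbTE ij) andbF mulr0.
Qed.

Lemma measurable_grad (L : R) (f : 'rV[R]_d -> R) : 0 < L -> lipschitz_gradient L f ->
  measurable_fun setT (grad f : borel_rV R d -> borel_rV R d).
Proof.
move=> L0 [_ lf]; apply: measurable_fun_rVP => j.
apply: measurable_continuous_rV => x A /nbhs_ballP[e /= e0 eA].
apply/nbhs_ballP; exists (e / 2 / (L * d.+1%:R)) => /=.
  by rewrite !divr_gt0// mulr_gt0.
move=> y [_ xy]; apply: eA => /=.
rewrite /ball/= (_ : grad f x 0 j - grad f y 0 j = (grad f x - grad f y) 0 j); last first.
  by rewrite !mxE.
apply: (@le_lt_trans _ _ (e / 2)); last by rewrite ltr_pdivrMr// ltr_pMr// ltr1n.
apply: le_trans (normr_coord_le _ _) _; apply: le_trans (lf _ _) _.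
rewrite mulrC -ler_pdivlMr//; apply: le_trans (norm2_le_sum _) _.
apply: (@le_trans _ _ (\sum_(i < d) (e / 2 / (L * d.+1%:R)))).
  by apply: ler_sum => i _; rewrite !mxE ltW//; exact: xy.
rewrite sumr_const card_ord -[leLHS]mulr_natr -[leLHS]mulrA ler_wpM2l//.
  by rewrite divr_ge0// ltW.
rewrite invfM -mulrA ler_piMr//; first by rewrite invr_ge0 ltW.
by rewrite ler_pdivrMl// mulr1 ler_nat.
Qed.

End Borel.

(** * Independence and Fubini's theorem *)

Section Independence.
Variables (R : realType) (dO : measure_display) (Omega : measurableType dO).
Variable P : probability Omega R.
Local Open Scope ereal_scope.

Section Pair.
Variables (dS dX : measure_display) (S : measurableType dS) (X : measurableType dX).
Variables (U : {mfun Omega >-> S}) (V : {mfun Omega >-> X}).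
Hypothesis indepUV : forall A B, measurable A -> measurable B ->
  P (U @^-1` A `&` V @^-1` B) = P (U @^-1` A) * P (V @^-1` B).

Let W (w : Omega) : S * X := (U w, V w).

Let mW : measurable_fun setT W.
Proof. exact: measurable_fun_pair. Qed.

HB.instance Definition _ := isMeasurableFun.Build _ _ _ _ W mW.

(* The law of an independent pair is the product of the laws. *)
Let joint_law (f : S * X -> \bar R) :
  \int[(distribution P U \x distribution P V)%E]_z f z = \int[distribution P W]_z f z.
Proof.
apply: eq_measure_integral => A mA _; apply: product_measure_unique => //.
Qed.

(** A bound on the conditional expectation given [U], integrated. *)
Lemma indep_tonelli_le (f : S * X -> \bar R) (c : R) : measurable_fun setT f ->
  (forall z, 0 <= f z) -> (forall s, \int[P]_w f (s, V w) <= c%:E) ->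
  \int[P]_w f (U w, V w) <= c%:E.
Proof.
move=> mf f0 fc.
rewrite -(@ge0_integral_distribution _ _ _ _ _ P W f mf f0) -joint_law fubini_tonelli1//.
apply: (@le_trans _ _ (\int[distribution P U]_s cst c%:E s)).
  apply: ge0_le_integral => //.
  - by move=> s _; apply: integral_ge0.
  - exact: measurable_fun_fubini_tonelli_F.
  - move=> s _; apply: le_trans (fc s).
    rewrite /fubini_F ge0_integral_distribution//.
    exact: measurable_fun_pair2.
by rewrite integral_cst//= [X in _ * X]probability_setT mule1.
Qed.

(** A function whose conditional expectation given [U] is zero has mean zero. *)
Lemma indep_fubini0 (f : S * X -> \bar R) : measurable_fun setT f ->
  P.-integrable setT (fun w => f (U w, V w)) ->
  (forall s, P.-integrable setT (fun w => f (s, V w)) /\ \int[P]_w f (s, V w) = 0) ->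
  \int[P]_w f (U w, V w) = 0.
Proof.
move=> mf intf f0.
rewrite -(@integral_distribution _ _ _ _ _ P W f mf intf) -joint_law.
rewrite -integral12_prod_meas1; last first.
  apply/integrableP; split => //.
  rewrite joint_law ge0_integral_distribution//; last exact: measurableT_comp.
  by case/integrableP : intf.
rewrite integral0_eq// => s _; rewrite /fubini_F integral_distribution ?(f0 s).2//.
  exact: measurable_fun_pair2.
exact: (f0 s).1.
Qed.

End Pair.

Section Family.
Variables (I : finType) (dX : I -> measure_display) (X : forall i, measurableType (dX i)).
Variable Y : forall i, {RV P >-> X i}.
Hypothesis indepY : mutually_independent Y.

(** The pi-system of the cylinder events of the variables other than [Y k]; the
    sigma-algebra that it generates is the information that they carry. *)
Definition others (k : I) : set (set Omega) :=
  [set E | exists2 A : forall i, set (X i), forall i, measurable (A i)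
     & E = \bigcap_(i in [set i | i != k]) (Y i @^-1` A i)].

Let measurable_cyl (J : set I) (A : forall i, set (X i)) :
  (forall i, measurable (A i)) ->
  measurable (\bigcap_(i in J) (Y i @^-1` A i)).
Proof.
move=> mA; apply: fin_bigcap_measurable => [|i _]; first exact: finite_finset.
by rewrite -[X in measurable X]setTI; exact: (measurable_funPT (Y i)).
Qed.

Lemma others_measurable k : others k `<=` measurable.
Proof. by move=> _ [A mA ->]; exact: measurable_cyl. Qed.

Lemma others_setI k : setI_closed (others k).
Proof.
move=> _ _ [A mA ->] [B mB ->]; exists (fun i => A i `&` B i).
  by move=> i; exact: measurableI.
by rewrite bigcapI.
Qed.

Lemma measurable_others k k' : k' != k ->
  measurable_fun setT (Y k' : g_sigma_algebraType (others k) -> X k').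
Proof.
move=> kk' _ B mB; rewrite setTI; apply: sub_sigma_algebra.
exists (@eqtype.dfwith _ (fun i => set (X i)) (fun i => [set: X i]) k' B).
  by move=> i; case: eqtype.dfwithP.
apply/seteqP; split=> [w Bw i _|w /(_ k')].
  by case: eqtype.dfwithP.
by rewrite /= dfwith_in; exact.
Qed.

(** The pi-lambda theorem extends independence from the cylinders to the whole
    sigma-algebra. *)
Lemma others_indep k A B : <<s others k >> A -> measurable B ->
  P (A `&` Y k @^-1` B) = P A * P (Y k @^-1` B).
Proof.
move=> sA mB.
have mYB : measurable (Y k @^-1` B).
  by rewrite -[X in measurable X]setTI; exact: (measurable_funPT (Y k)).
have p0 : (0 <= fine (P (Y k @^-1` B)))%R by rewrite fine_ge0.
have JE : [set` ([set: I] :\ k)%SET] = [set i | i != k].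
  by apply/seteqP; split=> i /=; rewrite !inE andbT.
have agree E : others k E ->
    mrestr P mYB E = mscale (NngNum p0) P E.
  move=> [C mC ->]; rewrite /mrestr /mscale /= fineK ?fin_num_measure//.
  have mC' i : measurable (eqtype.dfwith C B i) by case: eqtype.dfwithP.
  (* Independence of the whole family and of the family without [k]. *)
  have := indepY [set: I]%SET mC'; have := indepY ([set: I] :\ k)%SET mC.
  rewrite JE => -> h.
  have -> : \bigcap_(i in [set i | i != k]) Y i @^-1` C i `&` Y k @^-1` B =
      \bigcap_(i in [set` [set: I]%SET]) Y i @^-1` eqtype.dfwith C B i.
    apply/seteqP; split=> [w [wC wB] i _|w wD].
      by case: eqtype.dfwithP => // j kj; apply: wC; rewrite /= eq_sym.
    split=> [i /= ik|]; last first.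
      by have := wD k; rewrite /= dfwith_in; apply; rewrite /= inE.
    by have := wD i; rewrite /= dfwith_out 1?eq_sym//; apply; rewrite /= inE.
  rewrite h (bigD1 k)/= ?inE// dfwith_in; congr (_ * _).
  apply: eq_big => [i|i ik]; first by rewrite !inE andbT.
  by rewrite dfwith_out// eq_sym; case/andP: ik.
have : mrestr P mYB A = mscale (NngNum p0) P A.
  apply: (@g_sigma_algebra_measure_unique _ _ _ (others k)
    (@others_measurable k) (fun=> setT) _ _ (mrestr P mYB)
    (mscale (NngNum p0) P) (@others_setI k) agree _ A sA).
  - by move=> _; exists (fun=> setT) => //; apply/seteqP; split.
  - by apply/seteqP; split => // w _; exists 0%N.
  - by move=> _; rewrite /= /mrestr setTI ltey_eq fin_num_measure.
by rewrite /mrestr /mscale /= fineK ?fin_num_measure// muleC.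
Qed.

End Family.
End Independence.

(** * Square-integrable random vectors *)

Section MeasurableVectors.
Variables (R : realType) (d : nat) (dS : measure_display) (S : measurableType dS).
Implicit Types (g h : S -> borel_rV R d).

Lemma measurable_rV_coord g j : measurable_fun setT g ->
  measurable_fun setT (fun s => g s 0 j).
Proof. by move=> mg; exact: (measurableT_comp (@measurable_coord_rV R d j)). Qed.

Lemma measurable_rV_cst (v : 'rV[R]_d) : measurable_fun setT ((fun=> v) : S -> borel_rV R d).
Proof. exact: measurable_cst. Qed.

Lemma measurable_rV_add g h : measurable_fun setT g -> measurable_fun setT h ->
  measurable_fun setT ((fun s => g s + h s : 'rV[R]_d) : S -> borel_rV R d).
Proof.
move=> mg mh; apply: measurable_fun_rVP => j.
under eq_fun do rewrite mxE.
by apply: measurable_funD; exact: measurable_rV_coord.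
Qed.

Lemma measurable_rV_scale (c : R) g : measurable_fun setT g ->
  measurable_fun setT ((fun s => c *: (g s : 'rV[R]_d)) : S -> borel_rV R d).
Proof.
move=> mg; apply: measurable_fun_rVP => j.
under eq_fun do rewrite mxE.
by apply: measurable_funM => //; exact: measurable_rV_coord.
Qed.

Lemma measurable_rV_sub g h : measurable_fun setT g -> measurable_fun setT h ->
  measurable_fun setT ((fun s => g s - h s : 'rV[R]_d) : S -> borel_rV R d).
Proof.
move=> mg mh; under eq_fun do rewrite -scaleN1r.
by apply: measurable_rV_add => //; exact: measurable_rV_scale.
Qed.

Lemma measurable_rV_sum (I : Type) (r : seq I) (g : I -> S -> borel_rV R d) :
  (forall i, measurable_fun setT (g i)) ->
  measurable_fun setT ((fun s => \sum_(i <- r) (g i s : 'rV[R]_d)) : S -> borel_rV R d).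
Proof.
move=> mg; elim: r => [|i r IH].
  by under eq_fun do rewrite big_nil; exact: measurable_rV_cst.
by under eq_fun do rewrite big_cons; exact: measurable_rV_add.
Qed.

Lemma measurable_rV_mean (n : nat) (g : 'I_n -> S -> borel_rV R d) :
  (forall i, measurable_fun setT (g i)) ->
  measurable_fun setT ((fun s => mean (fun i => g i s : 'rV[R]_d)) : S -> borel_rV R d).
Proof. by move=> mg; apply: measurable_rV_scale; exact: measurable_rV_sum. Qed.

Lemma measurable_dotp g h : measurable_fun setT g -> measurable_fun setT h ->
  measurable_fun setT (fun s => dotp (g s) (h s)).
Proof.
move=> mg mh; apply: measurable_sum => j.
by apply: measurable_funM; exact: measurable_rV_coord.
Qed.

End MeasurableVectors.

Section Expectation.
Variables (R : realType) (dO : measure_display) (Omega : measurableType dO).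
Variable P : probability Omega R.
Implicit Types (u v : Omega -> R).

(** Integrable real random variables. *)
Definition integ u := P.-integrable setT (EFin \o u).

(** The real-valued expectation, meaningful for integrable variables. *)
Definition Ex u : R := (\int[P]_w u w)%R.

Lemma ExE u : integ u -> (\int[P]_w (u w)%:E = (Ex u)%:E)%E.
Proof. by move=> iu; rewrite /Ex /Rintegral fineK//; exact: integrable_fin_num. Qed.

Lemma integ_cst c : integ (fun=> c).
Proof. exact: finite_measure_integrable_cst. Qed.

Lemma integD u v : integ u -> integ v -> integ (fun w => u w + v w).
Proof. by move=> iu iv; have := integrableD measurableT iu iv. Qed.

Lemma integZ c u : integ u -> integ (fun w => c * u w).
Proof. by move=> iu; have := integrableZl measurableT c iu. Qed.

Lemma integ_sum (I : Type) (r : seq I) (u : I -> Omega -> R) :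
  (forall i, integ (u i)) -> integ (fun w => \sum_(i <- r) u i w).
Proof.
move=> iu; elim: r => [|i r IH].
  by under eq_fun do rewrite big_nil; exact: integ_cst.
by under eq_fun do rewrite big_cons; exact: integD.
Qed.

Lemma integ_le u v : measurable_fun setT u -> (forall w, `|u w| <= v w) ->
  integ v -> integ u.
Proof.
move=> mu uv; apply: le_integrable => //; first exact/measurable_EFinP.
by move=> w _; rewrite lee_fin (le_trans (uv w))// ler_norm.
Qed.

Lemma ExD u v : integ u -> integ v -> Ex (fun w => u w + v w) = Ex u + Ex v.
Proof. by move=> iu iv; rewrite /Ex RintegralD. Qed.

Lemma ExZ c u : integ u -> Ex (fun w => c * u w) = c * Ex u.
Proof. by move=> iu; rewrite /Ex RintegralZl. Qed.

Lemma Ex_cst c : Ex (fun=> c) = c.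
Proof. by rewrite /Ex Rintegral_cst//= probability_setT mulr1. Qed.

Lemma Ex_sum (I : Type) (r : seq I) (u : I -> Omega -> R) :
  (forall i, integ (u i)) ->
  Ex (fun w => \sum_(i <- r) u i w) = \sum_(i <- r) Ex (u i).
Proof.
move=> iu; elim: r => [|i r IH].
  by under [in LHS]eq_fun do rewrite big_nil; rewrite big_nil Ex_cst.
under [in LHS]eq_fun do rewrite big_cons.
by rewrite big_cons ExD ?IH//; exact: integ_sum.
Qed.

Lemma Ex_le u v : integ u -> integ v -> (forall w, u w <= v w) -> Ex u <= Ex v.
Proof. by move=> iu iv uv; rewrite /Ex; apply: le_Rintegral. Qed.

Variable d : nat.
Implicit Types (A B : Omega -> 'rV[R]_d).

(** Square-integrable random vectors. *)
Definition L2 A := measurable_fun setT (A : Omega -> borel_rV R d) /\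
  integ (fun w => sqn (A w)).

Lemma L2_measurable A : L2 A -> measurable_fun setT (A : Omega -> borel_rV R d).
Proof. by case. Qed.

Lemma L2_integ A : L2 A -> integ (fun w => sqn (A w)).
Proof. by case. Qed.

Lemma L2_cst (c : 'rV[R]_d) : L2 (fun=> c).
Proof. by split; [exact: measurable_rV_cst|exact: integ_cst]. Qed.

Lemma L2_le A B c c' : measurable_fun setT (A : Omega -> borel_rV R d) -> L2 B ->
  (forall w, sqn (A w) <= c * sqn (B w) + c') -> L2 A.
Proof.
move=> mA [mB iB] AB; split => //.
apply: (@integ_le _ (fun w => c * sqn (B w) + c')).
- exact: measurable_dotp.
- by move=> w; rewrite ger0_norm ?sqn_ge0.
- by apply: integD; [exact: integZ|exact: integ_cst].
Qed.

Lemma L2_dotp A B : L2 A -> L2 B -> integ (fun w => dotp (A w) (B w)).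
Proof.
move=> [mA iA] [mB iB].
apply: (@integ_le _ (fun w => sqn (A w) + sqn (B w))); last exact: integD.
  exact: measurable_dotp.
move=> w; have := sqn_ge0 (A w - B w); have := sqn_ge0 (A w + B w).
have := sqn_ge0 (A w); have := sqn_ge0 (B w).
by rewrite sqnB sqnD ler_norml => *; apply/andP; split; lra.
Qed.

Lemma L2D A B : L2 A -> L2 B -> L2 (fun w => A w + B w).
Proof.
move=> lA lB; split; first exact: measurable_rV_add (L2_measurable lA) (L2_measurable lB).
under eq_fun do rewrite sqnD.
by do 2?[apply: integD]; rewrite ?integZ ?L2_dotp ?L2_integ//; exact/integZ/L2_dotp.
Qed.

Lemma L2Z c A : L2 A -> L2 (fun w => c *: A w).
Proof.
move=> lA; split; first exact: measurable_rV_scale (L2_measurable lA).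
by under eq_fun do rewrite sqnZ; exact/integZ/L2_integ.
Qed.

Lemma L2B A B : L2 A -> L2 B -> L2 (fun w => A w - B w).
Proof.
move=> lA lB; have := L2D lA (L2Z (-1) lB).
by under eq_fun do rewrite scaleN1r.
Qed.

Lemma L2_sum (I : Type) (r : seq I) (A : I -> Omega -> 'rV[R]_d) :
  (forall i, L2 (A i)) -> L2 (fun w => \sum_(i <- r) A i w).
Proof.
move=> lA; elim: r => [|i r IH].
  by under eq_fun do rewrite big_nil; exact: L2_cst.
by under eq_fun do rewrite big_cons; exact: L2D.
Qed.

Lemma L2_mean (n : nat) (A : 'I_n -> Omega -> 'rV[R]_d) :
  (forall i, L2 (A i)) -> L2 (fun w => mean (fun i => A i w)).
Proof. by move=> lA; exact/L2Z/L2_sum. Qed.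

Lemma L2_grad (L : R) (f : 'rV[R]_d -> R) A : 0 < L -> lipschitz_gradient L f ->
  L2 A -> L2 (fun w => grad f (A w)).
Proof.
move=> L0 lf lA.
apply: (@L2_le _ A (2 * L ^+ 2) (2 * sqn (grad f 0))) => //.
  exact: (measurableT_comp (measurable_grad L0 lf) (L2_measurable lA)).
move=> w; have := sqnD_le2 (grad f (A w) - grad f 0) (grad f 0).
have := lipschitz_sqn (A w) 0 lf; rewrite subrK subr0; lra.
Qed.

End Expectation.

(** * The gradient noise *)

Section Noise.
Variables (R : realType) (d : nat) (dO : measure_display) (Omega : measurableType dO).
Variable P : probability Omega R.
Variables (I : finType) (dX : I -> measure_display) (X : forall i, measurableType (dX i)).
Variable Y : forall i, {RV P >-> X i}.
Hypothesis indepY : mutually_independent Y.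
Variable k : I.

(* The sample space with the sigma-algebra generated by the variables other
   than [Y k]; the identity [U] into it is a random variable. *)
Let S := g_sigma_algebraType (others Y k).

Let U (w : Omega) : S := w.

Let mU : measurable_fun setT U.
Proof.
move=> _ A mA; rewrite setTI; move: A mA; apply: smallest_sub.
  exact: sigma_algebra_measurable.
by move=> A oA; exact: (others_measurable oA).
Qed.

HB.instance Definition _ := isMeasurableFun.Build _ _ _ _ U mU.

Variables (G : 'rV[R]_d -> X k -> 'rV[R]_d) (g : 'rV[R]_d -> 'rV[R]_d) (sigma : R).
Hypothesis mG : measurable_fun [set: (borel_rV R d * X k)%type]
  (fun p => G p.1 p.2 : borel_rV R d).
Hypothesis mg : measurable_fun setT (g : borel_rV R d -> borel_rV R d).
Hypothesis Gmean : forall x j, P.-integrable setT (fun w => (G x (Y k w) 0 j)%:E) /\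
  'E_P[(fun w => G x (Y k w) 0 j)%R]%E = (g x 0 j)%:E.
Hypothesis Gvar : forall x,
  ('E_P[(fun w => norm2 (G x (Y k w) - g x) ^+ 2)%R] <= (sigma ^+ 2)%:E)%E.

Variable x : Omega -> 'rV[R]_d.
Hypothesis mx : measurable_fun setT (x : S -> borel_rV R d).

(* The point [x] does not depend on [Y k], so the gradient sample is unbiased
   conditionally on it. *)
Let noise w := G (x w) (Y k w) - g (x w).

Let noise_pair (p : S * X k) : borel_rV R d := (G (x p.1) p.2 : 'rV[R]_d) - g (x p.1).

Let indepU A B : measurable A -> measurable B ->
  P (U @^-1` A `&` Y k @^-1` B) = (P (U @^-1` A) * P (Y k @^-1` B))%E.
Proof. by move=> mA mB; exact: others_indep. Qed.

Let measurable_noise_pair : measurable_fun setT noise_pair.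
Proof.
have mx1 : measurable_fun [set: (S * X k)%type] (fun p => x p.1 : borel_rV R d).
  exact: (measurableT_comp mx measurable_fst).
have mG1 : measurable_fun [set: (S * X k)%type]
    (fun p => G (x p.1) p.2 : borel_rV R d).
  have mp : measurable_fun [set: (S * X k)%type]
      (fun p => (x p.1, p.2) : borel_rV R d * X k).
    by apply: measurable_fun_pair => //; exact: measurable_snd.
  exact: (measurableT_comp mG mp).
exact: (measurable_rV_sub mG1 (measurableT_comp mg mx1)).
Qed.

Lemma noise_measurable : measurable_fun setT (noise : Omega -> borel_rV R d).
Proof.
have mp : measurable_fun setT (fun w => (U w, Y k w)) by exact: measurable_fun_pair.
exact: (measurableT_comp measurable_noise_pair mp).
Qed.

Let noise_le : (\int[P]_w (sqn (noise w))%:E <= (sigma ^+ 2)%:E)%E.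
Proof.
apply: (indep_tonelli_le (U := U) (V := Y k) indepU
  (f := fun p => (sqn (noise_pair p))%:E)).
- by apply/measurable_EFinP; exact: measurable_dotp.
- by move=> z; rewrite lee_fin sqn_ge0.
- move=> s; have := Gvar (x s); rewrite unlock.
  by under eq_integral do rewrite norm2_sqr.
Qed.

Lemma L2_noise : L2 P noise.
Proof.
split; first exact: noise_measurable.
apply/integrableP; split.
  by apply/measurable_EFinP; exact: (measurable_dotp noise_measurable noise_measurable).
under eq_integral do rewrite /= ger0_norm ?sqn_ge0//.
by apply: le_lt_trans noise_le _; rewrite ltry.
Qed.

(** The conditional variance bound, integrated. *)
Lemma noise_variance : Ex P (fun w => sqn (noise w)) <= sigma ^+ 2.
Proof. by rewrite -lee_fin -ExE//; exact: L2_integ L2_noise. Qed.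

(** The noise at index [k] is orthogonal to every square-integrable vector that
    does not depend on [Y k]. *)
Lemma noise_orthogonal (A : Omega -> 'rV[R]_d) : L2 P A ->
  measurable_fun setT (A : S -> borel_rV R d) ->
  Ex P (fun w => dotp (A w) (noise w)) = 0.
Proof.
move=> lA mA; apply: EFin_inj; rewrite -ExE; last exact: L2_dotp lA L2_noise.
apply: (indep_fubini0 (U := U) (V := Y k) indepU
  (f := fun p => (dotp (A p.1) (noise_pair p))%:E)).
- apply/measurable_EFinP; apply: measurable_dotp => //.
  exact: (measurableT_comp mA measurable_fst).
- exact: L2_dotp lA L2_noise.
move=> s; rewrite /noise_pair /=.
have h j : integ P (fun w => A s 0 j * (G (x s) (Y k w) 0 j + - g (x s) 0 j)) /\
    Ex P (fun w => A s 0 j * (G (x s) (Y k w) 0 j + - g (x s) 0 j)) = 0.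
  have [iG EG] := Gmean (x s) j.
  have iG' : integ P (fun w => G (x s) (Y k w) 0 j + - g (x s) 0 j).
    by apply: integD; [exact: iG|exact: integ_cst].
  split; first exact: integZ.
  rewrite ExZ// ExD; [|exact: iG|exact: integ_cst].
  move: EG; rewrite unlock ExE// => -[->].
  by rewrite Ex_cst subrr mulr0.
have E : (fun w => dotp (A s) (G (x s) (Y k w) - g (x s))) =
  (fun w => \sum_j A s 0 j * (G (x s) (Y k w) 0 j + - g (x s) 0 j)).
  by apply/funext => w; apply: eq_bigr => j _; rewrite !mxE.
have iS : integ P (fun w => dotp (A s) (G (x s) (Y k w) - g (x s))).
  by rewrite E; apply: integ_sum => j; exact: (h j).1.
split; first exact: iS.
rewrite ExE// E Ex_sum; last by move=> j; exact: (h j).1.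
by rewrite big1// => j _; exact: (h j).2.
Qed.

End Noise.

(** * The local iteration *)

Section Recursion.
Variables (R : realType) (n d T tau : nat) (eta : R).
Variables (x g : nat -> 'I_n -> 'rV[R]_d).
Hypothesis tau0 : (0 < tau)%N.
Hypothesis recx : forall t i, (t < T)%N ->
  x t.+1 i =
    if (tau %| t.+1)%N then
      mean (x (t.+1 - tau)%N)
      - (eta / n%:R) *: \sum_(j < n) \sum_(k < tau) g (t - k)%N j
    else x t i - eta *: g t i.

(** Communication replaces the local points by their mean: the synchronised
    update is the mean of the local ones. *)
Lemma local_sgd_step t i : (t < T)%N ->
  x t.+1 i = if (tau %| t.+1)%N then mean (fun j => x t j - eta *: g t j)
             else x t i - eta *: g t i.
Proof.
move=> tT; rewrite recx//; case: ifPn => // dvd.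
have taut : (tau <= t.+1)%N by apply: dvdn_leq.
pose s := (t.+1 - tau)%N.
have dvds : (tau %| s)%N by rewrite dvdn_subl.
have tE : t = (s + tau.-1)%N by rewrite /s; lia.
have round k : (k < tau)%N ->
    mean (x (s + k)%N) = mean (x s) - eta *: \sum_(l < k) mean (g (s + l)%N).
  elim: k => [_|k IH kt]; first by rewrite addn0 big_ord0 scaler0 subr0.
  rewrite addnS; have -> : x (s + k).+1 = (fun j => x (s + k)%N j - eta *: g (s + k)%N j).
    apply/funext => j; rewrite recx; last by lia.
    by rewrite -addnS dvdn_addr// gtnNdvd.
  by rewrite meanD meanN meanZ IH ?(ltnW kt)// big_ord_recr/= scalerDr opprD addrA.
have mt : mean (x t) = mean (x s) - eta *: \sum_(l < tau.-1) mean (g (s + l)%N).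
  by rewrite {1}tE round// prednK.
rewrite meanD meanN meanZ mt -addrA -opprD -scalerDr.
have -> : \sum_(l < tau.-1) mean (g (s + l)%N) + mean (g t)
    = \sum_(l < tau) mean (g (s + l)%N).
  by rewrite tE -[in RHS](prednK tau0) big_ord_recr.
rewrite /mean -scaler_sumr scalerA exchange_big/=; congr (_ - _ *: _).
rewrite (reindex_inj rev_ord_inj)/=; apply: eq_bigr => k _.
by have := ltn_ord k => kt; apply: eq_bigr => j _; congr (g _ _); lia.
Qed.

Lemma local_sgd_mean t : (0 < n)%N -> (t < T)%N ->
  mean (x t.+1) = mean (x t) - eta *: mean (g t).
Proof.
move=> n0 tT.
have -> : mean (x t) - eta *: mean (g t) = mean (fun j => x t j - eta *: g t j).
  by rewrite meanD meanN meanZ.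
have -> : x t.+1 = (fun i => if (tau %| t.+1)%N
    then mean (fun j => x t j - eta *: g t j) else x t i - eta *: g t i).
  by apply/funext => i; exact: local_sgd_step.
by case: (tau %| t.+1)%N; rewrite ?mean_cst.
Qed.

End Recursion.

(** * Expected decrease of the objective *)

Section LocalSGD.
Variables (R : realType) (n d : nat) (f : 'I_n -> 'rV[R]_d -> R) (L : R).
Variables (tau T : nat) (x0 : 'rV[R]_d) (sigma eta : R).
Variables (dO : measure_display) (Omega : measurableType dO) (P : probability Omega R).
Variables (dX : 'I_n -> measure_display) (X : forall i, measurableType (dX i)).
Variable xi : forall i, nat -> {RV P >-> X i}.
Variable G : forall i, 'rV[R]_d -> X i -> 'rV[R]_d.
Variable x : nat -> 'I_n -> Omega -> 'rV[R]_d.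
Hypothesis n0 : (0 < n)%N.
Hypothesis L0 : 0 < L.
Hypothesis lf : forall i, lipschitz_gradient L (f i).
Hypothesis tau2 : (2 <= tau)%N.
Hypothesis samples : stochastic_samples T xi.
Hypothesis oracle : stochastic_oracle T f sigma xi G.
Hypothesis sgd : local_sgd T tau xi G x0 eta x.

Let tau0 : (0 < tau)%N. Proof. exact: ltnW tau2. Qed.

(* The gradient sample of worker [i] at time [t], and its noise. *)
Let g t i w := @G i (x t i w) (xi i t w).

Let N t i w := g t i w - grad (f i) (x t i w).

Let recx w t i : (t < T)%N ->
  x t.+1 i w = if (tau %| t.+1)%N then mean (fun j => x t j w - eta *: g t j w)
             else x t i w - eta *: g t i w.
Proof.
move=> tT; apply: (@local_sgd_step _ n d T tau eta (fun t i => x t i w)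
  (fun t i => g t i w)) => // s j sT.
by case: sgd => _; exact.
Qed.

Let meanx w t : (t < T)%N ->
  mean (fun i => x t.+1 i w) = mean (fun i => x t i w) - eta *: mean (fun i => g t i w).
Proof.
move=> tT; apply: (@local_sgd_mean _ n d T tau eta (fun t i => x t i w)
  (fun t i => g t i w)) => // s j sT.
by case: sgd => _; exact.
Qed.

(** The map [u] stands for the identity, defined on the sample space with a
    coarser sigma-algebra. *)
Lemma gradient_measurable (dS : measure_display) (S : measurableType dS)
    (u : S -> Omega) t i :
  measurable_fun setT (xi i t \o u) ->
  measurable_fun setT ((fun s => x t i (u s)) : S -> borel_rV R d) ->
  measurable_fun setT ((fun s => g t i (u s)) : S -> borel_rV R d).
Proof.
move=> mxi mx; case: oracle => mG _.
have mp : measurable_fun setT ((fun s => (x t i (u s), xi i t (u s)))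
    : S -> (borel_rV R d * X i)%type) by exact: measurable_fun_pair.
exact: (measurableT_comp (mG i) mp).
Qed.

(** The iterates at time [t] are functions of the samples drawn before [t]. *)
Lemma iterate_measurable (dS : measure_display) (S : measurableType dS)
    (u : S -> Omega) t : (t <= T)%N ->
  (forall i s, (s < t)%N -> measurable_fun setT (xi i s \o u)) ->
  forall i, measurable_fun setT ((fun s => x t i (u s)) : S -> borel_rV R d).
Proof.
elim: t => [_ _ i|t IH tT mxi i].
  by under eq_fun do rewrite sgd.1; exact: measurable_rV_cst.
have mx j : measurable_fun setT ((fun s => x t j (u s)) : S -> borel_rV R d).
  by apply: IH (ltnW tT) _ j => j' s st; apply: mxi; exact: ltnW.
have mg j : measurable_fun setT ((fun s => g t j (u s)) : S -> borel_rV R d).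
  by apply: gradient_measurable => //; exact: mxi.
have step j := measurable_rV_sub (mx j) (measurable_rV_scale eta (mg j)).
under eq_fun do rewrite recx//.
by case: (tau %| t.+1)%N; [exact: measurable_rV_mean|exact: step].
Qed.

Let Y (it : 'I_n * 'I_T) : {RV P >-> X it.1} := xi it.1 it.2.

Let indepY : mutually_independent Y.
Proof. exact: samples.1. Qed.

(** [unaffected i t A] : the vector [A] does not depend on the sample of worker
    [i] at time [t]. *)
Definition unaffected i t (A : Omega -> 'rV[R]_d) := forall tT : (t < T)%N,
  measurable_fun setT
    (A : g_sigma_algebraType (others Y (i, Ordinal tT)) -> borel_rV R d).

Lemma unaffected_sample i t (tT : (t < T)%N) j s : (s < T)%N ->
  (j, s) != (i, t) ->
  measurable_fun setT
    (xi j s : g_sigma_algebraType (others Y (i, Ordinal tT)) -> X j).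
Proof.
move=> sT ne; apply: (@measurable_others _ _ _ _ _ _ _ Y _ (j, Ordinal sT)).
by apply: contra ne => /eqP[-> ->].
Qed.

Lemma unaffected_iterate i t s j : (s <= t)%N -> unaffected i t (x s j).
Proof.
move=> st tT.
apply: (@iterate_measurable _ (g_sigma_algebraType (others Y (i, Ordinal tT))) id).
  exact: leq_trans st (ltnW tT).
move=> j' r rs; apply: unaffected_sample.
  exact: ltn_trans rs (leq_ltn_trans st tT).
by apply/eqP => -[_ rt]; move: rs; rewrite rt ltnNge st.
Qed.

Lemma unaffected_grad i t h A : lipschitz_gradient L h ->
  unaffected i t A -> unaffected i t (fun w => grad h (A w)).
Proof. by move=> lh uA tT; exact: (measurableT_comp (measurable_grad L0 lh) (uA tT)). Qed.

Lemma unaffected_noise i t j : j != i -> unaffected i t (N t j).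
Proof.
move=> ji tT; apply: measurable_rV_sub; last first.
  by apply: unaffected_grad => //; exact: unaffected_iterate.
apply: (@gradient_measurable _
  (g_sigma_algebraType (others Y (i, Ordinal tT))) id); last exact: unaffected_iterate.
by apply: unaffected_sample => //; apply: contra ji => /eqP[->].
Qed.

Lemma noise_L2_orth i t : (t < T)%N ->
  [/\ L2 P (N t i), Ex P (fun w => sqn (N t i w)) <= sigma ^+ 2 &
    forall A, L2 P A -> unaffected i t A ->
      Ex P (fun w => dotp (A w) (N t i w)) = 0].
Proof.
move=> tT; case: oracle => mG o.
pose k := (i, Ordinal tT) : 'I_n * 'I_T.
have mx := @unaffected_iterate i t t i (leqnn t) tT.
have mgr := measurable_grad L0 (lf i).
have h1 z j := (o i t tT z).1 j.
have h2 z := (o i t tT z).2.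
split.
- exact: (L2_noise (Y := Y) indepY (k := k) (mG i) mgr h2 mx).
- exact: (noise_variance (Y := Y) indepY (k := k) (mG i) mgr h2 mx).
- move=> A lA uA.
  exact: (noise_orthogonal (Y := Y) indepY (k := k) (mG i) mgr h1 h2 mx lA (uA tT)).
Qed.

Lemma noise_L2 i t : (t < T)%N -> L2 P (N t i).
Proof. by move=> tT; have [] := noise_L2_orth i tT. Qed.

Lemma iterate_L2 t i : (t <= T)%N -> L2 P (x t i).
Proof.
elim: t i => [i _|t IH i tT].
  have -> : x 0%N i = (fun=> x0) by apply/funext => w; exact: sgd.1.
  exact: L2_cst.
have lx j : L2 P (x t j) by apply: IH; exact: ltnW.
have lg j : L2 P (g t j).
  have := L2D (noise_L2 j tT) (L2_grad L0 (lf j) (lx j)).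
  by rewrite /N; under eq_fun do rewrite subrK.
have step j := L2B (lx j) (L2Z eta (lg j)).
have -> : x t.+1 i = (fun w => if (tau %| t.+1)%N
    then mean (fun j => x t j w - eta *: g t j w) else x t i w - eta *: g t i w).
  by apply/funext => w; exact: recx.
by case: (tau %| t.+1)%N; [exact: L2_mean|exact: step].
Qed.

(** The variance of the averaged noise is reduced by the number of workers,
    because the noises of different workers are orthogonal. *)
Lemma mean_noise_variance t : (t < T)%N ->
  Ex P (fun w => sqn (mean (fun i => N t i w))) <= sigma ^+ 2 / n%:R.
Proof.
move=> tT.
have iN i j : integ P (fun w => dotp (N t i w) (N t j w)).
  by apply: L2_dotp; exact: noise_L2.
have E w : sqn (mean (fun i => N t i w)) =
    n%:R^-1 ^+ 2 * \sum_i \sum_j dotp (N t i w) (N t j w).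
  rewrite /mean sqnZ /sqn dotp_suml; congr (_ * _).
  by apply: eq_bigr => i _; rewrite dotp_sumr.
under eq_fun do rewrite E.
rewrite ExZ; last by apply: integ_sum => i; exact: integ_sum.
rewrite Ex_sum; last by move=> i; exact: integ_sum.
apply: (@le_trans _ _ (n%:R^-1 ^+ 2 * \sum_(i < n) sigma ^+ 2)).
  rewrite ler_wpM2l ?sqr_ge0//; apply: ler_sum => i _.
  rewrite Ex_sum// (bigD1 i)//= big1 ?addr0; first by have [] := noise_L2_orth i tT.
  move=> j ji; have [_ _] := noise_L2_orth j tT; apply; first exact: noise_L2.
  by apply: unaffected_noise; rewrite eq_sym.
rewrite sumr_const card_ord -[X in _ * X]mulr_natr.
have nR : n%:R != 0 :> R by rewrite pnatr_eq0 -lt0n.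
by rewrite le_eqVlt; apply/orP; left; apply/eqP; field.
Qed.

Lemma mean_noise_orthogonal t A : (t < T)%N -> L2 P A -> (forall i, unaffected i t A) ->
  Ex P (fun w => dotp (A w) (mean (fun i => N t i w))) = 0.
Proof.
move=> tT lA uA.
have E w : dotp (A w) (mean (fun i => N t i w)) =
    n%:R^-1 * \sum_i dotp (A w) (N t i w) by rewrite /mean dotpZr dotp_sumr.
under eq_fun do rewrite E.
have iN i : integ P (fun w => dotp (A w) (N t i w)) by exact/L2_dotp/noise_L2.
rewrite ExZ; last exact: integ_sum.
rewrite Ex_sum// big1 ?mulr0// => i _.
by have [_ _] := noise_L2_orth i tT; apply.
Qed.


Section Convergence.
Variables (zeta delta M fstar : R) (h : 'rV[R]_d -> R).
Hypothesis eta0 : 0 < eta.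
Hypothesis etaL : 18 * (eta * tau%:R) * L <= 1.
Hypothesis gsim : gradient_similarity zeta f.
Hypothesis hsim : hessian_similarity delta f.
Hypothesis hh : conv_hull f h.
Hypothesis M0 : 0 <= M.
Hypothesis lh : lipschitz_hessian M h.
Hypothesis fmin : forall v, fstar <= favg f v.

Let tR : 2 <= tau%:R :> R. Proof. by rewrite ler_nat. Qed.

Let etaL_tau : 3 * (eta * L) <= (2 * tau%:R)^-1.
Proof.
have t2 := tR; rewrite -[leRHS]mul1r ler_pdivlMr; last by lra.
apply: le_trans etaL; rewrite -subr_ge0.
rewrite (_ : _ - _ = 12 * (eta * tau%:R * L)); last by ring.
by rewrite mulr_ge0// mulr_ge0 ?(ltW L0)// mulr_ge0// ltW.
Qed.

Let etaL_small : eta * L <= 1 / 2.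
Proof.
have t2 := tR; have := etaL_tau.
have : (2 * tau%:R)^-1 <= 4^-1 :> R by rewrite lef_pV2 ?posrE; lra.
lra.
Qed.

(** At a communication time all the workers are at the same point. *)
Lemma sync_eq s i j w : (tau %| s)%N -> (s <= T)%N -> x s i w = x s j w.
Proof.
case: s => [_ _|s dvd sT]; first by rewrite !sgd.1.
by rewrite !recx// dvd.
Qed.

Lemma L2_gd (k : nat) (u : 'rV[R]_d -> R) A : lipschitz_gradient L u ->
  L2 P A -> L2 P (fun w => gd eta u k (A w)).
Proof.
move=> lu lA; elim: k => //= k IH.
exact: (L2B IH (L2Z eta (L2_grad L0 lu IH))).
Qed.

Lemma unaffected_gd i t (k : nat) (u : 'rV[R]_d -> R) A : lipschitz_gradient L u ->
  unaffected i t A -> unaffected i t (fun w => gd eta u k (A w)).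
Proof.
move=> lu uA tT; elim: k => [|k IH]; first exact: uA.
apply: measurable_rV_sub => //; apply: measurable_rV_scale.
exact: (measurableT_comp (measurable_grad L0 lu) IH).
Qed.

(** Within a round, a local trajectory departs from noiseless gradient descent
    started at the same point by a mean square of order [eta^2 sigma^2] per
    step; the noise at each step is orthogonal to the deviation so far. *)
Lemma noise_drift s k i : (tau %| s)%N -> (k < tau)%N -> (s + k <= T)%N ->
  Ex P (fun w => sqn (x (s + k)%N i w - gd eta (f i) k (x s i w)))
    <= 2 * k%:R * (eta ^+ 2 * sigma ^+ 2).
Proof.
move=> dvds kt skT.
pose u k' := Ex P (fun w => sqn (x (s + k')%N i w - gd eta (f i) k' (x s i w))).
apply: (@discrete_gronwall R tau k u) => //.
- exact: ltnW.
- by rewrite mulr_ge0 ?sqr_ge0.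
- by rewrite /u addn0; under eq_fun do rewrite subrr sqn0; rewrite Ex_cst.
move=> {}k' k'k; rewrite /u.
set t := (s + k')%N.
have tT : (t < T)%N by rewrite /t; lia.
pose y w := gd eta (f i) k' (x s i w).
pose A w := (x t i w - y w) - eta *: (grad (f i) (x t i w) - grad (f i) (y w)).
have lx : L2 P (x t i) by apply: iterate_L2; exact: ltnW.
have ly : L2 P y by apply: L2_gd => //; apply: iterate_L2; lia.
have lA : L2 P A.
  exact: (L2B (L2B lx ly) (L2Z eta (L2B (L2_grad L0 (lf i) lx) (L2_grad L0 (lf i) ly)))).
have uA : unaffected i t A.
  have ux : unaffected i t (x t i) by exact: unaffected_iterate.
  have uy : unaffected i t y.
    by apply: unaffected_gd => //; apply: unaffected_iterate; rewrite /t leq_addr.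
  move=> tT'; apply: measurable_rV_sub.
    exact: measurable_rV_sub (ux tT') (uy tT').
  apply: measurable_rV_scale; apply: measurable_rV_sub.
    exact: (unaffected_grad (lf i) ux).
  exact: (unaffected_grad (lf i) uy).
have [lN vN oN] := noise_L2_orth i tT.
have E w : sqn (x (s + k'.+1)%N i w - gd eta (f i) k'.+1 (x s i w)) =
    sqn (A w) + (- (2 * eta) * dotp (A w) (N t i w) + eta ^+ 2 * sqn (N t i w)).
  have ndvd : (tau %| t.+1)%N = false.
    by rewrite /t -addnS dvdn_addr// gtnNdvd//; lia.
  rewrite addnS -/t recx// ndvd /= -/(y w).
  have -> : x t i w - eta *: g t i w - (y w - eta *: grad (f i) (y w))
      = A w - eta *: N t i w.
    rewrite /A /N; move: (g t i w) (grad (f i) (x t i w)) (grad (f i) (y w)).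
    move: (x t i w) (y w) => *; by apply/rowP => j; rewrite !mxE; ring.
  by rewrite sqnB sqnZ dotpZr; ring.
under eq_fun do rewrite E.
have iAN := L2_dotp lA lN.
have iN2 := L2_integ lN.
rewrite ExD; [|exact: L2_integ|by apply: integD; exact: integZ].
rewrite ExD; [|exact: integZ|exact: integZ].
rewrite !ExZ// oN// mulr0 add0r; apply: lerD; last by rewrite ler_wpM2l ?sqr_ge0.
have iD : integ P (fun w => sqn (x t i w - y w)) by apply: L2_integ; exact: L2B.
rewrite -ExZ//; apply: Ex_le; [exact: L2_integ|exact: integZ|move=> w].
apply: le_trans (gd_step_expand _ _ (ltW eta0) L0 _ (lf i)) _; first by have := etaL_small; lra.
by rewrite ler_wpM2r ?sqn_ge0// lerD2l.
Qed.

(* The noiseless local trajectories, restarted at each communication. *)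
Let y t i w := gd eta (f i) (t %% tau) (x (t - t %% tau)%N i w).

Let W := 10 * (eta * tau%:R) ^+ 2 * zeta ^+ 2.

(** The noiseless trajectories stay close to their mean, on every sample path. *)
Lemma client_drift t w : (t < T)%N ->
  avg (fun i => sqn (y t i w - mean (fun i => y t i w))) <= W.
Proof.
move=> tT; set k := (t %% tau)%N; set s := (t - k)%N.
have dvds : (tau %| s)%N by rewrite /s /k {1}(divn_eq t tau) addnK dvdn_mull.
have sT : (s <= T)%N by rewrite /s; lia.
pose i0 := Ordinal n0.
have -> : (fun i => y t i w) = (fun i => gd eta (f i) k (x s i0 w)).
  by apply/funext => i; rewrite /y -/k -/s (sync_eq i i0).
under eq_fun do rewrite /y -/k -/s (sync_eq _ i0 w dvds sT).
apply: le_trans (avg_sqn_mean n0 _ (gd eta (favg f) k (x s i0 w))) _.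
apply: (gd_drift (L := L)) => //; first exact: ltW.
by rewrite ltnW// ltn_mod.
Qed.

(* The gradient at the mean iterate, its estimate by the local gradients, and
   the averaged noise. *)
Let a t w := grad (favg f) (mean (fun i => x t i w)).
Let b t w := mean (fun i => grad (f i) (x t i w)).
Let m t w := mean (fun i => N t i w).

(** Bound for the mean squared bias: noise drift, dissimilarity of the Hessians,
    and curvature of [h]. *)
Definition bias_bound : R :=
  12 * (L ^+ 2 * (tau%:R * (eta ^+ 2 * sigma ^+ 2)))
  + 24 * delta ^+ 2 * W + 6 * M ^+ 2 * W ^+ 2.

Let L2_a t : (t <= T)%N -> L2 P (a t).
Proof.
move=> tT; apply: (L2_grad (L := L)) => //.
  exact: lipschitz_gradient_favg.
by apply: L2_mean => i; exact: iterate_L2.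
Qed.

Let L2_b t : (t <= T)%N -> L2 P (b t).
Proof.
by move=> tT; apply: L2_mean => i; apply: (L2_grad (L := L)) => //; exact: iterate_L2.
Qed.

Let L2_m t : (t < T)%N -> L2 P (m t).
Proof. by move=> tT; apply: L2_mean => i; exact: noise_L2. Qed.

Lemma bias_expectation t : (t < T)%N ->
  Ex P (fun w => sqn (b t w - a t w)) <= bias_bound.
Proof.
move=> tT; have tT' := ltnW tT.
have lD i : L2 P (fun w => x t i w - y t i w).
  apply: L2B; first exact: iterate_L2.
  by apply: L2_gd => //; apply: iterate_L2; lia.
have iS : integ P (fun w => \sum_(i < n) sqn (x t i w - y t i w)).
  by apply: integ_sum => i; exact: L2_integ (lD i).
have iA : integ P (fun w => avg (fun i => sqn (x t i w - y t i w))) by exact: integZ.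
apply: (@le_trans _ _ (Ex P (fun w => 6 * L ^+ 2 * avg (fun i => sqn (x t i w - y t i w))
    + (24 * delta ^+ 2 * W + 6 * M ^+ 2 * W ^+ 2)))).
  apply: Ex_le.
  - by apply: L2_integ; apply: L2B; [exact: L2_b|exact: L2_a].
  - by apply: integD; [exact: integZ|exact: integ_cst].
  - move=> w; rewrite addrA; apply: (bias_le n0 L0 lf hsim hh M0 lh); exact: client_drift.
rewrite ExD; [|exact: integZ|exact: integ_cst].
rewrite Ex_cst /bias_bound -addrA lerD2r ExZ// /avg ExZ//.
rewrite Ex_sum; last by move=> i; exact: L2_integ (lD i).
have k2 : 2 * (t %% tau)%:R * (eta ^+ 2 * sigma ^+ 2) <=
          2 * tau%:R * (eta ^+ 2 * sigma ^+ 2).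
  apply: ler_wpM2r; first by rewrite mulr_ge0 ?sqr_ge0.
  by rewrite ler_pM2l// ler_nat ltnW// ltn_mod.
have hD i : Ex P (fun w => sqn (x t i w - y t i w)) <=
    2 * tau%:R * (eta ^+ 2 * sigma ^+ 2).
  apply: le_trans k2; have kt : (t %% tau < tau)%N by rewrite ltn_mod.
  have := @noise_drift (t - t %% tau)%N (t %% tau)%N i _ kt _.
  have kle : (t %% tau <= t)%N by exact: leq_mod.
  rewrite subnK//; apply=> //.
  by rewrite {1}(divn_eq t tau) addnK dvdn_mull.
have : avg (fun i => Ex P (fun w => sqn (x t i w - y t i w)))
    <= 2 * tau%:R * (eta ^+ 2 * sigma ^+ 2).
  by rewrite -[leRHS](avg_cst n0); exact: avg_le.
have L6 : 0 <= 6 * L ^+ 2 by rewrite mulr_ge0 ?sqr_ge0.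
move=> /(ler_wpM2l L6); rewrite /avg; lra.
Qed.

(* The vector against which the averaged noise is tested. *)
Let Q t w := (2 * L * eta ^+ 2) *: b t w - eta *: a t w.

(** What one step guarantees along every sample path. *)
Lemma step_descent t w : (t < T)%N ->
  favg f (mean (fun i => x t.+1 i w)) <= favg f (mean (fun i => x t i w))
  - (eta / 2 * sqn (a t w) - (eta / 2 * sqn (b t w - a t w)
      + (L * eta ^+ 2 * sqn (m t w) + dotp (Q t w) (m t w)))).
Proof.
move=> tT; rewrite meanx//.
have -> : mean (fun i => g t i w) = b t w + m t w.
  by rewrite /b /m -meanD; congr mean; apply/funext => i; rewrite /N addrC subrK.
apply: le_trans (descent _ _ L0 (lipschitz_gradient_favg n0 L0 lf)) _.
rewrite -addrA lerD2l -/(a t w) /Q.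
move: (a t w) (b t w) (m t w) => a' b' m'.
rewrite sqnN sqnZ !dotpE sqnD sqnB (dotpC b' a').
have sb := sqn_ge0 b'.
have : (eta * L) * (eta * sqn b') <= 1 / 2 * (eta * sqn b').
  by rewrite ler_wpM2r ?etaL_small// mulr_ge0// ltW.
lra.
Qed.

Lemma Q_orthogonal t : (t < T)%N -> Ex P (fun w => dotp (Q t w) (m t w)) = 0.
Proof.
move=> tT; have tT' := ltnW tT; apply: mean_noise_orthogonal => //.
  by apply: L2B; apply: L2Z; [exact: L2_b|exact: L2_a].
move=> i tT1; apply: measurable_rV_sub; apply: measurable_rV_scale.
  apply: measurable_rV_mean => j; apply: unaffected_grad => //.
  exact: unaffected_iterate.
apply: unaffected_grad; first exact: lipschitz_gradient_favg.
by move=> tT2; apply: measurable_rV_mean => j; exact: unaffected_iterate.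
Qed.

(** The pathwise decrease, summed over the run and integrated. *)
Lemma sum_gradients_le :
  eta / 2 * \sum_(t < T) Ex P (fun w => sqn (a t w)) <=
  favg f x0 - fstar
  + T%:R * (eta / 2 * bias_bound + L * eta ^+ 2 * (sigma ^+ 2 / n%:R)).
Proof.
pose Z t w := eta / 2 * sqn (a t w) + (- (eta / 2) * sqn (b t w - a t w)
   + (- (L * eta ^+ 2) * sqn (m t w) + -1 * dotp (Q t w) (m t w))).
have tel j w : (j <= T)%N ->
    favg f (mean (fun i => x j i w)) <= favg f x0 - \sum_(t < j) Z t w.
  elim: j => [_|j IH jT].
    by rewrite big_ord0 subr0; under eq_fun do rewrite sgd.1; rewrite mean_cst.
  apply: le_trans (step_descent w jT) _.
  rewrite big_ord_recr/= /Z; have := IH (ltnW jT); lra.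
have path w : \sum_(t < T) Z t w <= favg f x0 - fstar.
  by have := tel T w (leqnn T); have := fmin (mean (fun i => x T i w)); lra.
have parts (t : 'I_T) : [/\ L2 P (a t), L2 P (b t), L2 P (m t) & L2 P (Q t)].
  have tT := ltn_ord t; have tT' := ltnW tT.
  split; [exact: L2_a|exact: L2_b|exact: L2_m|].
  by apply: L2B; apply: L2Z; [exact: L2_b|exact: L2_a].
have iZ3 (t : 'I_T) : integ P (fun w => - (L * eta ^+ 2) * sqn (m t w)
     + -1 * dotp (Q t w) (m t w)).
  by have [_ _ lm lQ] := parts t; apply: integD; apply: integZ;
     [exact: L2_integ|exact: L2_dotp].
have iZ2 (t : 'I_T) : integ P (fun w => - (eta / 2) * sqn (b t w - a t w)).
  by have [la lb _ _] := parts t; apply/integZ/L2_integ; exact: L2B.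
have iZ1 (t : 'I_T) : integ P (fun w => eta / 2 * sqn (a t w)).
  by have [la _ _ _] := parts t; apply/integZ/L2_integ.
have iZ (t : 'I_T) : integ P (Z t).
  by apply: integD => //; apply: integD.
have EZ (t : 'I_T) : eta / 2 * Ex P (fun w => sqn (a t w))
    - (eta / 2 * bias_bound + L * eta ^+ 2 * (sigma ^+ 2 / n%:R)) <= Ex P (Z t).
  have [la lb lm lQ] := parts t.
  rewrite /Z ExD//; last exact: integD.
  rewrite ExD// ExD; [|exact/integZ/L2_integ|exact/integZ/L2_dotp].
  rewrite !ExZ; [|exact: L2_dotp|exact: L2_integ|by apply: L2_integ; exact: L2B
                 |exact: L2_integ].
  rewrite Q_orthogonal//.
  have e2 : 0 <= eta / 2 by rewrite divr_ge0// ltW.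
  have Le : 0 <= L * eta ^+ 2 by rewrite mulr_ge0 ?sqr_ge0// ltW.
  have := ler_wpM2l e2 (bias_expectation (ltn_ord t)).
  have := ler_wpM2l Le (mean_noise_variance (ltn_ord t)).
  rewrite /m /N; lra.
have : Ex P (fun w => \sum_(t < T) Z t w) <= favg f x0 - fstar.
  rewrite -[leRHS](Ex_cst P); apply: Ex_le => //; first exact: integ_sum.
  exact: integ_cst.
rewrite Ex_sum// => EZ_le.
have : \sum_(t < T) (eta / 2 * Ex P (fun w => sqn (a t w))
    - (eta / 2 * bias_bound + L * eta ^+ 2 * (sigma ^+ 2 / n%:R)))
    <= \sum_(t < T) Ex P (Z t) by apply: ler_sum => t _; exact: EZ.
rewrite sumrB sumr_const card_ord -mulr_sumr -[X in _ - X]mulr_natl; lra.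
Qed.

End Convergence.
End LocalSGD.

(** * Choice of the stepsize *)

Section Tuning.
Variable R : realType.

Lemma scaled_power_le (c g r : R) (p : nat) : 0 <= r -> 0 <= g * c * r <= 1 ->
  (g * c) ^+ p * r ^+ p.+1 <= r.
Proof.
move=> r0 /andP[h0 h1]; rewrite exprS mulrCA -exprMn ler_piMr//.
exact: exprn_ile1.
Qed.

(** [A2], ..., [A5] are the coefficients of the powers of [g] in the error bound
    and [r2], ..., [r5] the corresponding rates.  [g] is the product of the stepsize and the round length. Its inverse is the
    sum of [18 * L] and of the rates divided by [Delta / K], so that each of the
    error terms is at most a multiple of the corresponding rate; no case
    distinction on the vanishing of a rate is needed. *)
Lemma stepsize_exists (L Delta K A2 A3 A4 A5 r2 r3 r4 r5 : R) :
  0 < L -> 0 < Delta -> 0 < K ->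
  0 <= r2 -> 0 <= r3 -> 0 <= r4 -> 0 <= r5 ->
  A2 * Delta = r2 ^+ 2 * K -> A3 * Delta ^+ 2 = r3 ^+ 3 * K ^+ 2 ->
  A4 * Delta ^+ 2 = r4 ^+ 3 * K ^+ 2 -> A5 * Delta ^+ 4 = r5 ^+ 5 * K ^+ 4 ->
  exists2 g : R, 0 < g /\ 18 * g * L <= 1 &
    2 * Delta / (g * K) + 2 * (g * A2) + 240 * (g ^+ 2 * A3)
      + 12 * (g ^+ 2 * A4) + 600 * (g ^+ 4 * A5)
    <= 602 * (L * Delta / K + r2 + r3 + r4 + r5).
Proof.
move=> L0 D0 K0 r20 r30 r40 r50 e2 e3 e4 e5.
pose c := K / Delta.
have c0 : 0 < c by rewrite divr_gt0.
pose s := 18 * L + c * r2 + c * r3 + c * r4 + c * r5.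
have cr r : 0 <= r -> 0 <= c * r by move=> r0; rewrite mulr_ge0// ltW.
have := cr _ r20; have := cr _ r30; have := cr _ r40; have := cr _ r50.
move=> c5 c4 c3 c2.
have s0 : 0 < s by rewrite /s; lra.
have g0 : 0 < s^-1 by rewrite invr_gt0.
have small u : 0 <= u -> u <= s -> 0 <= s^-1 * u <= 1.
  by move=> u0 us; rewrite mulr_ge0 ?(ltW g0)//= mulrC ler_pdivrMr// mul1r.
have rate r p A : 0 <= r -> c * r <= s -> A = c ^+ p * r ^+ p.+1 ->
    s^-1 ^+ p * A <= r.
  move=> r0 rs ->; rewrite mulrA -exprMn; apply: scaled_power_le => //.
  by rewrite -mulrA; apply: small => //; exact: cr.
have Dn : Delta != 0 by rewrite gt_eqF.
have Kn : K != 0 by rewrite gt_eqF.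
have h2 : s^-1 ^+ 1 * A2 <= r2.
  apply: rate => //; first by rewrite /s; lra.
  by apply: (mulIf Dn); rewrite e2 /c; field.
have h3 : s^-1 ^+ 2 * A3 <= r3.
  apply: rate => //; first by rewrite /s; lra.
  by apply: (mulIf (expf_neq0 2 Dn)); rewrite e3 /c; field.
have h4 : s^-1 ^+ 2 * A4 <= r4.
  apply: rate => //; first by rewrite /s; lra.
  by apply: (mulIf (expf_neq0 2 Dn)); rewrite e4 /c; field.
have h5 : s^-1 ^+ 4 * A5 <= r5.
  apply: rate => //; first by rewrite /s; lra.
  by apply: (mulIf (expf_neq0 4 Dn)); rewrite e5 /c; field.
exists s^-1.
  split=> //; rewrite mulrAC ler_pdivrMr// mul1r /s; lra.
have -> : 2 * Delta / (s^-1 * K) = 36 * (L * Delta / K) + 2 * (r2 + r3 + r4 + r5).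
  rewrite invfM invrK /s /c; field; exact/andP.
have r1 : 0 <= L * Delta / K by rewrite divr_ge0 ?mulr_ge0 ?ltW.
rewrite expr1 in h2; lra.
Qed.

Lemma powR_expn (a : R) (p q : nat) : 0 <= a -> (0 < q)%N ->
  (a `^ (p%:R / q%:R)) ^+ q = a ^+ p.
Proof.
move=> a0 q0; rewrite -powR_mulrn ?powR_ge0// -powRrM divfK ?powR_mulrn//.
by rewrite pnatr_eq0 -lt0n.
Qed.

End Tuning.

Theorem theorem3 (R : realType) :
  exists C : R, 0 < C /\
  forall (n d : nat) (f : 'I_n -> 'rV[R]_d -> R) (L : R)
    (tau K T : nat) (x0 : 'rV[R]_d) (fstar Delta sigma zeta delta M : R)
    (dO : measure_display) (Omega : measurableType dO) (P : probability Omega R)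
    (dX : 'I_n -> measure_display) (X : forall i, measurableType (dX i))
    (xi : forall i, nat -> {RV P >-> X i})
    (G : forall i, 'rV[R]_d -> X i -> 'rV[R]_d),
  (0 < n)%N -> (0 < d)%N -> 0 < L ->
  (forall i, lipschitz_gradient L (f i)) ->
  has_lbound (range (favg f)) ->
  fstar = inf (range (favg f)) ->
  Delta = favg f x0 - fstar ->
  0 < Delta ->
  (2 <= tau)%N -> (0 < K)%N -> T = (tau * K)%N ->
  0 <= sigma ->
  stochastic_samples T xi ->
  stochastic_oracle T f sigma xi G ->
  0 <= zeta -> gradient_similarity zeta f ->
  0 <= delta <= 2 * L -> hessian_similarity delta f ->
  0 <= M -> (exists2 h, conv_hull f h & lipschitz_hessian M h) ->
  exists eta : R, 0 < eta /\
  forall x : nat -> 'I_n -> Omega -> 'rV[R]_d,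
    local_sgd T tau xi G x0 eta x ->
    ((T%:R^-1)%:E *
       \sum_(t < T)
         'E_P[(fun w => norm2 (grad (favg f) (mean (fun i => x t i w))) ^+ 2)%R]
     <= (C * (L * Delta / K%:R
              + Num.sqrt (L * Delta * sigma ^+ 2 / (n%:R * tau%:R * K%:R))
              + (delta * Delta * zeta / K%:R) `^ (2 / 3)
              + (L * Delta * sigma) `^ (2 / 3)
                / (tau%:R `^ (1 / 3) * K%:R `^ (2 / 3))
              + (M ^+ 2 * Delta ^+ 4 * zeta ^+ 4 / K%:R ^+ 4) `^ (1 / 5)))%R%:E)%E.
Proof.
(* [602 = 600 + 2]: the largest coefficient is that of [r5], from the curvature
   term and from [2 * Delta / (g * K)]. *)
exists 602; split => // n d f L tau K T x0 fstar Delta sigma zeta delta M dO Omega P dX X xi G.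
move=> n0 _ L0 lf lb fstarE DeltaE D0 tau2 K0 TE sigma0 samples oracle zeta0 gsim.
move=> /andP[delta0 _] hsim M0 [h hh lh].
have KR : 0 < K%:R :> R by rewrite ltr0n.
have nR : 0 < n%:R :> R by rewrite ltr0n.
have tR : 0 < tau%:R :> R by rewrite ltr0n ltnW.
have Kn : K%:R != 0 :> R by rewrite gt_eqF.
have nn : n%:R != 0 :> R by rewrite gt_eqF.
have tn : tau%:R != 0 :> R by rewrite gt_eqF.
have D0' := ltW D0; have L0' := ltW L0; have KR' := ltW KR; have tR' := ltW tR.
set r2 := Num.sqrt _; set r3 := (delta * _ * _ / _) `^ _; set r4 := _ `^ _ / _.
set r5 := (M ^+ 2 * _ * _ / _) `^ _.
have e2 : r2 ^+ 2 = L * Delta * sigma ^+ 2 / (n%:R * tau%:R * K%:R).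
  by rewrite /r2 sqr_sqrtr// divr_ge0 ?mulr_ge0 ?sqr_ge0// ltW.
have e3 : r3 ^+ 3 = (delta * Delta * zeta / K%:R) ^+ 2.
  by rewrite /r3 (@powR_expn R _ 2 3)// divr_ge0 ?mulr_ge0.
have e4 : r4 ^+ 3 = (L * Delta * sigma) ^+ 2 / (tau%:R * K%:R ^+ 2).
  rewrite /r4 expr_div_n exprMn (@powR_expn R _ 2 3)//; last by rewrite !mulr_ge0.
  by rewrite (@powR_expn R _ 1 3)// (@powR_expn R _ 2 3)// expr1.
have e5 : r5 ^+ 5 = M ^+ 2 * Delta ^+ 4 * zeta ^+ 4 / K%:R ^+ 4.
  rewrite /r5 (@powR_expn R _ 1 5)// .
  by rewrite divr_ge0 ?mulr_ge0 ?exprn_ge0.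
have [g [g0 gL] hg] := @stepsize_exists R L Delta K%:R
  (L * sigma ^+ 2 / (n%:R * tau%:R)) (delta ^+ 2 * zeta ^+ 2)
  (L ^+ 2 * sigma ^+ 2 / tau%:R) (M ^+ 2 * zeta ^+ 4) r2 r3 r4 r5 L0 D0 KR
  (sqrtr_ge0 _) (powR_ge0 _ _) (divr_ge0 (powR_ge0 _ _) (mulr_ge0 (powR_ge0 _ _) (powR_ge0 _ _)))
  (powR_ge0 _ _)
  ltac:(rewrite e2; field; exact/and3P) ltac:(rewrite e3; field => //)
  ltac:(rewrite e4; field; exact/andP) ltac:(rewrite e5; field => //).
exists (g / tau%:R); split; first by rewrite divr_gt0.
move=> x sgd.
have fmin v : fstar <= favg f v by rewrite fstarE; apply: ge_inf => //; exists v.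
have gE : g / tau%:R * tau%:R = g by rewrite divfK.
have etaL : 18 * (g / tau%:R * tau%:R) * L <= 1 by rewrite gE.
have eta0 : 0 < g / tau%:R by rewrite divr_gt0.
have := sum_gradients_le n0 L0 lf tau2 samples oracle sgd eta0 etaL gsim hsim hh M0 lh fmin.
rewrite -DeltaE.
set S := \sum_(t < T) _ => hS.
have -> : (\sum_(t < T)
   'E_P[(fun w => norm2 (grad (favg f) (mean (fun i => x t i w))) ^+ 2)%R])%E = S%:E.
  rewrite /S -sumEFin; apply: eq_bigr => t _; rewrite unlock.
  under eq_integral do rewrite norm2_sqr.
  apply: ExE; apply: L2_integ.
  apply: (L2_grad (L := L)) => //; first exact: lipschitz_gradient_favg.
  apply: L2_mean => i.
  exact: (iterate_L2 L0 lf tau2 samples oracle sgd i (ltnW (ltn_ord t))).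
rewrite -EFinM lee_fin; apply: le_trans hg.
have TR : T%:R = tau%:R * K%:R :> R by rewrite TE natrM.
have gn : g != 0 by rewrite gt_eqF.
have -> : T%:R^-1 * S = 2 / (g * K%:R) * (g / tau%:R / 2 * S).
  by rewrite TR; field; exact/and3P.
have c0 : 0 <= 2 / (g * K%:R) by rewrite divr_ge0// mulr_ge0// ltW.
apply: le_trans (ler_wpM2l c0 hS) _.
rewrite le_eqVlt; apply/orP; left; apply/eqP.
rewrite TR /bias_bound gE; field; exact/and4P.
Qed.
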